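(* Let $G$ be a countable group and $L_0$ a proper length function on $G$. Then $G$ does not have the Haagerup property if and only if $G$ has relative property FH with respect to some sequence $(\mu_n)_{n\in\mathbf{N}}$ of symmetric probability measures on $G$ such that, for every $n$, $\mu_n$ is supported on a finite subset of $\{g\in G: L_0(g)\ge n\}$.
   Context: A length function on $G$ is $L:G\to\mathbf{R}_+$ with $L(1)=0$, $L(gh)\le L(g)+L(h)$, $L(g^{-1})=L(g)$; it is proper if $\{g: L(g)\le r\}$ is finite for every $r$. A Hilbert length on $G$ is a function of the form $L(g)=|F(g)-F(1)|$ where $F:G\to\mathcal{H}$ is a map into a Hilbert space satisfying $|F(hg)-F(hg')|=|F(g)-F(g')|$ for all $g,g',h\in G$ (equivalently $L(g)=\sigma(1,g)$ for a left-invariant pseudo-metric $\sigma$ pulled back from a Hilbert space). $G$ has the Haagerup property if it admits a metrically proper action by affine isometries on a Hilbert space (equivalently, a proper Hilbert length). A probability measure $\mu$ on $G$ is symmetric if $\mu(g)=\mu(g^{-1})$; $\mathbf{E}_\mu(f)=\sum_g f(g)\mu(g)$. $G$ has relative property FH with respect to a sequence of probability measures $(\mu_n)$ if there exists $K>0$ such that for every Hilbert length $L$ with $L(g)\le L_0(g)$ for all $g$, and every $n$, $\mathbf{E}_{\mu_n}(L^2)\le K$ (this notion does not depend on the choice of proper length $L_0$). *)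

(* Defs.v *)
From Stdlib Require Import Reals Lra List.
Import ListNotations.
Open Scope R_scope.

Record Group := {
  gcar :> Type;
  gmul : gcar -> gcar -> gcar;
  ginv : gcar -> gcar;
  gone : gcar;
  gmul_assoc : forall a b c, gmul a (gmul b c) = gmul (gmul a b) c;
  gmul_1l : forall a, gmul gone a = a;
  gmul_1r : forall a, gmul a gone = a;
  gmul_Vl : forall a, gmul (ginv a) a = gone;
  gmul_Vr : forall a, gmul a (ginv a) = gone
}.
Arguments gmul {g} _ _.
Arguments ginv {g} _.
Arguments gone {g}.

Definition countable (T : Type) : Prop :=
  exists f : T -> nat, forall x y, f x = f y -> x = y.

Definition finite_pred {T : Type} (P : T -> Prop) : Prop :=
  exists l : list T, forall x, P x -> In x l.

Record HilbertSpace := {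
  hcar :> Type;
  hadd : hcar -> hcar -> hcar;
  hzero : hcar;
  hopp : hcar -> hcar;
  hscal : R -> hcar -> hcar;
  hinner : hcar -> hcar -> R;
  hadd_assoc : forall x y z, hadd x (hadd y z) = hadd (hadd x y) z;
  hadd_comm : forall x y, hadd x y = hadd y x;
  hadd_0l : forall x, hadd hzero x = x;
  hadd_oppr : forall x, hadd x (hopp x) = hzero;
  hscal_1 : forall x, hscal 1 x = x;
  hscal_assoc : forall a b x, hscal a (hscal b x) = hscal (a * b) x;
  hscal_addr : forall a x y, hscal a (hadd x y) = hadd (hscal a x) (hscal a y);
  hscal_addl : forall a b x, hscal (a + b) x = hadd (hscal a x) (hscal b x);
  hinner_sym : forall x y, hinner x y = hinner y x;
  hinner_addl : forall x y z, hinner (hadd x y) z = hinner x z + hinner y z;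
  hinner_scall : forall a x y, hinner (hscal a x) y = a * hinner x y;
  hinner_nonneg : forall x, 0 <= hinner x x;
  hinner_def : forall x, hinner x x = 0 -> x = hzero;
  hcomplete : forall u : nat -> hcar,
    (forall eps, 0 < eps -> exists N, forall m n, (N <= m)%nat -> (N <= n)%nat ->
        sqrt (hinner (hadd (u m) (hopp (u n))) (hadd (u m) (hopp (u n)))) < eps) ->
    exists l, forall eps, 0 < eps -> exists N, forall n, (N <= n)%nat ->
        sqrt (hinner (hadd (u n) (hopp l)) (hadd (u n) (hopp l))) < eps
}.

Definition hdist (H : HilbertSpace) (x y : H) : R :=
  sqrt (hinner H (hadd H x (hopp H y)) (hadd H x (hopp H y))).

Definition length_function (G : Group) (L : G -> R) : Prop :=
  (forall g, 0 <= L g) /\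
  L gone = 0 /\
  (forall g h, L (gmul g h) <= L g + L h) /\
  (forall g, L (ginv g) = L g).

Definition proper_length (G : Group) (L : G -> R) : Prop :=
  forall r, finite_pred (fun g => L g <= r).

Definition hilbert_length (G : Group) (L : G -> R) : Prop :=
  exists (H : HilbertSpace) (F : G -> H),
    (forall g g' h, hdist H (F (gmul h g)) (F (gmul h g')) = hdist H (F g) (F g')) /\
    (forall g, L g = hdist H (F g) (F gone)).

Definition affine_isometric_action (G : Group) (H : HilbertSpace)
    (alpha : G -> H -> H) : Prop :=
  (forall x, alpha gone x = x) /\
  (forall g h x, alpha (gmul g h) x = alpha g (alpha h x)) /\
  (forall g x y, hdist H (alpha g x) (alpha g y) = hdist H x y) /\
  (forall g t x y, alpha g (hadd H (hscal H t x) (hscal H (1 - t) y)) =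
                   hadd H (hscal H t (alpha g x)) (hscal H (1 - t) (alpha g y))).

(** metrically proper: for every bounded set B (it suffices to take closed
    balls B(x,r)), the set {g | g B meets B} is finite *)
Definition metrically_proper (G : Group) (H : HilbertSpace)
    (alpha : G -> H -> H) : Prop :=
  forall (x : H) (r : R),
    finite_pred (fun g => exists y : H, hdist H y x <= r /\ hdist H (alpha g y) x <= r).

Definition haagerup (G : Group) : Prop :=
  exists (H : HilbertSpace) (alpha : G -> H -> H),
    affine_isometric_action G H alpha /\ metrically_proper G H alpha.

Definition sum_list {T : Type} (f : T -> R) (l : list T) : R :=
  fold_right (fun x acc => f x + acc) 0 l.

Definition finite_support_list {T : Type} (mu : T -> R) (S : list T) : Prop :=
  NoDup S /\ (forall x, mu x <> 0 -> In x S).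

Definition expectation_le {T : Type} (mu : T -> R) (f : T -> R) (K : R) : Prop :=
  forall S, finite_support_list mu S -> sum_list (fun x => f x * mu x) S <= K.

Definition symmetric_measure (G : Group) (mu : G -> R) : Prop :=
  forall g, mu g = mu (ginv g).

Definition prob_supported_far (G : Group) (L0 : G -> R) (n : nat) (mu : G -> R) : Prop :=
  (forall g, 0 <= mu g) /\
  exists S : list G, finite_support_list mu S /\
    (forall g, In g S -> INR n <= L0 g) /\
    sum_list mu S = 1.

Definition relative_FH (G : Group) (L0 : G -> R) (mu : nat -> G -> R) : Prop :=
  exists K : R, 0 < K /\
    forall L : G -> R, hilbert_length G L -> (forall g, L g <= L0 g) ->
      forall n : nat, expectation_le (mu n) (fun g => (L g) ^ 2) K.

(* Main.v *)
Require Import Defs.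
From Stdlib Require Import Reals List.
From Stdlib Require Import Lra Lia Factorial Permutation Classical ClassicalEpsilon.
From Stdlib Require Import FunctionalExtensionality ProofIrrelevance.
Import ListNotations.
Open Scope R_scope.

(** Call [psi : G -> R] of negative type when the kernel
    [(psi x + psi y - psi (x^-1 y)) / 2] is positive semidefinite and
    [psi 1 = 0]; by the GNS construction these are the squares of the Hilbert
    lengths, and the Haagerup property means that some such [psi] is proper.

    Let [C] be the set of [psi] of negative type with [psi <= L0^2]. It is
    convex, and compact for pointwise convergence. If [G] is not Haagerup,
    there is [kappa] such that no [psi] in [C] exceeds [kappa] off a ball of
    [L0]: otherwise a weighted series of functions of [C] would be proper. By
    compactness, for every [n] some finite shell [n <= L0 <= m] meets
    [psi <= kappa] for all [psi] in [C], and a minimax argument turns this into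
    a single probability measure on the shell with [E psi <= kappa + 1].

    Conversely, if [psi] is proper of negative type and vanishes on the finite
    subgroup [L0 = 0], then for small [t] the function
    [2 M (1 - exp (- t psi))] lies in [C] and is at least [M] off a finite
    set; for [M] large this contradicts relative property FH. *)

(** * Limits of real sequences *)

Lemma Un_cv_const (a : R) : Un_cv (fun _ => a) a.
Proof.
  intros eps He; exists 0%nat; intros n _.
  unfold Rdist; rewrite Rminus_diag, Rabs_R0; exact He.
Qed.

Lemma Un_cv_ge (u : nat -> R) (l a : R) (N : nat) :
  (forall n, (N <= n)%nat -> a <= u n) -> Un_cv u l -> a <= l.
Proof.
  intros Hu Hl; apply Rnot_lt_le; intros Hlt.
  destruct (Hl (a - l)) as [M HM]; [lra|].
  specialize (HM (max N M) ltac:(lia)); specialize (Hu (max N M) ltac:(lia)).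
  unfold Rdist in HM; apply Rabs_def2 in HM; lra.
Qed.

Lemma Un_cv_le (u : nat -> R) (l a : R) (N : nat) :
  (forall n, (N <= n)%nat -> u n <= a) -> Un_cv u l -> l <= a.
Proof.
  intros Hu Hl; apply Rnot_lt_le; intros Hlt.
  destruct (Hl (l - a)) as [M HM]; [lra|].
  specialize (HM (max N M) ltac:(lia)); specialize (Hu (max N M) ltac:(lia)).
  unfold Rdist in HM; apply Rabs_def2 in HM; lra.
Qed.

Lemma Un_cv_squeeze0 (u v : nat -> R) (l : R) :
  Un_cv u l ->
  (forall eps, 0 < eps -> exists N, forall n, (N <= n)%nat -> Rabs (u n - v n) <= eps) ->
  Un_cv v l.
Proof.
  intros Hu Huv eps He.
  destruct (Hu (eps / 2)) as [N1 H1]; [lra|].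
  destruct (Huv (eps / 4)) as [N2 H2]; [lra|].
  exists (max N1 N2); intros n Hn.
  specialize (H1 n ltac:(lia)); specialize (H2 n ltac:(lia)).
  unfold Rdist in *.
  replace (v n - l) with ((u n - l) - (u n - v n)) by ring.
  eapply Rle_lt_trans; [apply Rabs_triang|]; rewrite Rabs_Ropp; lra.
Qed.

Lemma inv_INR_small (eps : R) : 0 < eps ->
  exists N, forall n, (N <= n)%nat -> / (INR n + 1) < eps.
Proof.
  intros He; destruct (INR_unbounded (/ eps)) as [N HN]; exists N; intros n Hn.
  apply le_INR in Hn.
  assert (0 < / eps) by (apply Rinv_0_lt_compat; lra).
  rewrite <- (Rinv_inv eps); apply Rinv_lt_contravar; [nra|lra].
Qed.

Lemma inv_INR_pos (n : nat) : 0 < / (INR n + 1).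
Proof. apply Rinv_0_lt_compat; pose proof (pos_INR n); lra. Qed.

Lemma sqrt_le_of_sq (x y : R) : 0 <= y -> x <= y * y -> sqrt x <= y.
Proof.
  intros Hy Hx; rewrite <- (sqrt_square y Hy); apply sqrt_le_1_alt; exact Hx.
Qed.

(** * Finite sums over lists *)

Lemma sum_list_app {T} (f : T -> R) (l m : list T) :
  sum_list f (l ++ m) = sum_list f l + sum_list f m.
Proof. induction l as [|x l IH]; simpl; [ring|rewrite IH; ring]. Qed.

Lemma sum_list_map {S T} (h : S -> T) (f : T -> R) (l : list S) :
  sum_list f (map h l) = sum_list (fun x => f (h x)) l.
Proof. induction l as [|x l IH]; simpl; [|rewrite IH]; reflexivity. Qed.

Lemma sum_list_ext {T} (f g : T -> R) (l : list T) :
  (forall x, In x l -> f x = g x) -> sum_list f l = sum_list g l.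
Proof.
  induction l as [|x l IH]; simpl; intros H; [reflexivity|].
  rewrite H by auto; rewrite IH by auto; reflexivity.
Qed.

Lemma sum_list_plus {T} (f g : T -> R) (l : list T) :
  sum_list (fun x => f x + g x) l = sum_list f l + sum_list g l.
Proof. induction l as [|x l IH]; simpl; [ring|rewrite IH; ring]. Qed.

Lemma sum_list_scal {T} (a : R) (f : T -> R) (l : list T) :
  sum_list (fun x => a * f x) l = a * sum_list f l.
Proof. induction l as [|x l IH]; simpl; [ring|rewrite IH; ring]. Qed.

Lemma sum_list_le {T} (f g : T -> R) (l : list T) :
  (forall x, In x l -> f x <= g x) -> sum_list f l <= sum_list g l.
Proof.
  induction l as [|x l IH]; simpl; intros H; [lra|].
  apply Rplus_le_compat; auto.
Qed.

Lemma sum_list_nonneg {T} (f : T -> R) (l : list T) :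
  (forall x, In x l -> 0 <= f x) -> 0 <= sum_list f l.
Proof.
  induction l as [|x l IH]; simpl; intros H; [lra|].
  apply Rplus_le_le_0_compat; auto.
Qed.

Lemma sum_list_exchange {S T} (f : S -> T -> R) (l : list S) (m : list T) :
  sum_list (fun x => sum_list (f x) m) l = sum_list (fun y => sum_list (fun x => f x y) l) m.
Proof.
  induction l as [|x l IH]; simpl.
  - induction m as [|y m IHm]; simpl; [|rewrite <- IHm; simpl]; ring.
  - rewrite IH, <- sum_list_plus; reflexivity.
Qed.

Lemma sum_list_perm {T} (f : T -> R) (l m : list T) :
  Permutation l m -> sum_list f l = sum_list f m.
Proof. induction 1; simpl; lra. Qed.

Lemma sum_list_cv {T} (f : nat -> T -> R) (g : T -> R) (l : list T) :
  (forall x, In x l -> Un_cv (fun n => f n x) (g x)) ->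
  Un_cv (fun n => sum_list (f n) l) (sum_list g l).
Proof.
  induction l as [|x l IH]; simpl; intros H.
  - apply Un_cv_const.
  - apply (CV_plus (fun n => f n x) (fun n => sum_list (f n) l)); auto.
Qed.

(** ** Positive semidefinite forms *)

(* No vector space axioms are required of [add] and [scal], so that formal
   linear combinations, represented by lists, are covered. *)
Record semi_inner {T : Type} (add : T -> T -> T) (scal : R -> T -> T)
    (B : T -> T -> R) : Prop := {
  si_sym : forall x y, B x y = B y x;
  si_addl : forall x y z, B (add x y) z = B x z + B y z;
  si_scall : forall a x y, B (scal a x) y = a * B x y;
  si_nonneg : forall x, 0 <= B x x
}.

(** Subtraction is spelled with [scal (-1)], so that one definition serves formal combinations, the
    function space and abstract Hilbert spaces. *)
Definition sdist {T : Type} (add : T -> T -> T) (scal : R -> T -> T)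
    (B : T -> T -> R) (x y : T) : R :=
  sqrt (B (add x (scal (-1) y)) (add x (scal (-1) y))).

Lemma si_addr {T add scal B} (HB : @semi_inner T add scal B) x y z :
  B x (add y z) = B x y + B x z.
Proof. rewrite (si_sym _ _ _ HB), (si_addl _ _ _ HB), !(si_sym _ _ _ HB x); reflexivity. Qed.

Lemma si_scalr {T add scal B} (HB : @semi_inner T add scal B) a x y :
  B x (scal a y) = a * B x y.
Proof. rewrite (si_sym _ _ _ HB), (si_scall _ _ _ HB), (si_sym _ _ _ HB x); reflexivity. Qed.

Lemma si_comb {T add scal B} (HB : @semi_inner T add scal B) a x y :
  B (add x (scal a y)) (add x (scal a y)) = B x x + 2 * a * B x y + a * a * B y y.
Proof.
  rewrite (si_addl _ _ _ HB), !(si_addr HB), !(si_scall _ _ _ HB), !(si_scalr HB).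
  rewrite (si_sym _ _ _ HB y x); ring.
Qed.

(** The polynomial [a |-> B (x + a y) (x + a y)] is nonnegative, in particular at its minimizer
    [- B x y / B y y]. *)
Lemma si_cauchy_schwarz {T add scal B} (HB : @semi_inner T add scal B) x y :
  B x y * B x y <= B x x * B y y.
Proof.
  assert (Hp : forall a, 0 <= B x x + 2 * a * B x y + a * a * B y y).
  { intros a; rewrite <- (si_comb HB); apply (si_nonneg _ _ _ HB). }
  destruct (Req_dec (B y y) 0) as [H0|H0].
  (* The form may be degenerate. When [B y y = 0] the polynomial is affine in [a], and a nonzero
     slope would let it take the value -1. *)
  - destruct (Req_dec (B x y) 0) as [H1|H1]; [rewrite H1, H0; lra|].
    specialize (Hp (- (B x x + 1) / (2 * B x y))); rewrite H0 in Hp.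
    replace (2 * (- (B x x + 1) / (2 * B x y)) * B x y) with (- (B x x + 1)) in Hp
      by (field; exact H1).
    lra.
  - assert (0 < B y y) by (pose proof (si_nonneg _ _ _ HB y); lra).
    specialize (Hp (- B x y / B y y)).
    replace (B x x + 2 * (- B x y / B y y) * B x y +
             - B x y / B y y * (- B x y / B y y) * B y y)
      with ((B x x * B y y - B x y * B x y) / B y y) in Hp by (field; exact H0).
    apply Rnot_lt_le; intros Hlt.
    assert ((B x x * B y y - B x y * B x y) / B y y < 0); [|lra].
    apply Rdiv_neg_pos; lra.
Qed.

Lemma si_abs_le {T add scal B} (HB : @semi_inner T add scal B) x y :
  Rabs (B x y) <= sqrt (B x x) * sqrt (B y y).
Proof.
  rewrite <- sqrt_mult by apply (si_nonneg _ _ _ HB).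
  rewrite <- sqrt_Rsqr_abs; apply sqrt_le_1_alt; apply (si_cauchy_schwarz HB).
Qed.

Lemma si_minkowski {T add scal B} (HB : @semi_inner T add scal B) x y :
  sqrt (B (add x y) (add x y)) <= sqrt (B x x) + sqrt (B y y).
Proof.
  pose proof (sqrt_pos (B x x)); pose proof (sqrt_pos (B y y)).
  apply sqrt_le_of_sq; [lra|].
  rewrite (si_addl _ _ _ HB), !(si_addr HB), (si_sym _ _ _ HB y x).
  pose proof (si_abs_le HB x y) as Hxy; pose proof (Rle_abs (B x y)).
  pose proof (sqrt_sqrt _ (si_nonneg _ _ _ HB x)).
  pose proof (sqrt_sqrt _ (si_nonneg _ _ _ HB y)).
  nra.
Qed.

Lemma sdist_sym {T add scal B} (HB : @semi_inner T add scal B) x y :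
  sdist add scal B x y = sdist add scal B y x.
Proof.
  unfold sdist; rewrite !(si_comb HB), (si_sym _ _ _ HB y x); f_equal; ring.
Qed.

Lemma sdist_triangle {T add scal B} (HB : @semi_inner T add scal B) x y z :
  sdist add scal B x z <= sdist add scal B x y + sdist add scal B y z.
Proof.
  unfold sdist.
  eapply Rle_trans;
    [|apply (si_minkowski HB (add x (scal (-1) y)) (add y (scal (-1) z)))].
  right; f_equal.
  repeat rewrite ?(si_addl _ _ _ HB), ?(si_addr HB), ?(si_scall _ _ _ HB),
    ?(si_scalr HB).
  rewrite (si_sym _ _ _ HB y x), (si_sym _ _ _ HB z x), (si_sym _ _ _ HB z y); ring.
Qed.

Lemma sdist_nonneg {T : Type} (add : T -> T -> T) scal B (x y : T) :
  0 <= sdist add scal B x y.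
Proof. apply sqrt_pos. Qed.

Lemma si_norm_le_sdist {T add scal B} (HB : @semi_inner T add scal B) x y :
  sqrt (B x x) <= sdist add scal B x y + sqrt (B y y).
Proof.
  unfold sdist; eapply Rle_trans; [|apply (si_minkowski HB (add x (scal (-1) y)))].
  right; f_equal.
  repeat rewrite ?(si_addl _ _ _ HB), ?(si_addr HB), ?(si_scall _ _ _ HB),
    ?(si_scalr HB).
  rewrite (si_sym _ _ _ HB y x); ring.
Qed.

(** ** Kernels and formal linear combinations *)

(** A list of pairs [(c, x)] stands for the formal combination of the point masses [c delta_x]; [ev]
    is the linear extension of [f] to such combinations. *)
Definition ev {X : Type} (f : X -> R) (u : list (R * X)) : R :=
  sum_list (fun p => fst p * f (snd p)) u.

Definition lscal {X : Type} (a : R) (u : list (R * X)) : list (R * X) :=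
  map (fun p => (a * fst p, snd p)) u.

Definition bform {X : Type} (k : X -> X -> R) (u v : list (R * X)) : R :=
  ev (fun x => ev (k x) v) u.

Definition psd {X : Type} (k : X -> X -> R) : Prop :=
  (forall x y, k x y = k y x) /\ forall u, 0 <= bform k u u.

Lemma ev_app {X} (f : X -> R) u v : ev f (u ++ v) = ev f u + ev f v.
Proof. apply sum_list_app. Qed.

Lemma ev_lscal {X} (f : X -> R) a u : ev f (lscal a u) = a * ev f u.
Proof.
  unfold ev, lscal; rewrite sum_list_map, <- sum_list_scal.
  apply sum_list_ext; intros; simpl; ring.
Qed.

Lemma ev_ext {X} (f g : X -> R) u : (forall x, f x = g x) -> ev f u = ev g u.
Proof. intros H; apply sum_list_ext; intros; rewrite H; reflexivity. Qed.

Lemma ev_plus {X} (f g : X -> R) u : ev (fun x => f x + g x) u = ev f u + ev g u.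
Proof.
  unfold ev; rewrite <- sum_list_plus; apply sum_list_ext; intros; ring.
Qed.

Lemma ev_scal {X} a (f : X -> R) u : ev (fun x => a * f x) u = a * ev f u.
Proof.
  unfold ev; rewrite <- sum_list_scal; apply sum_list_ext; intros; ring.
Qed.

Lemma ev_const {X} a (u : list (R * X)) : ev (fun _ => a) u = a * ev (fun _ => 1) u.
Proof. rewrite <- ev_scal; apply ev_ext; intros; ring. Qed.

Lemma ev_single {X} (f : X -> R) x : ev f [(1, x)] = f x.
Proof. unfold ev; simpl; ring. Qed.

Lemma ev_exchange {X Y} (k : X -> Y -> R) u v :
  ev (fun x => ev (k x) v) u = ev (fun y => ev (fun x => k x y) u) v.
Proof.
  unfold ev.
  transitivity (sum_list (fun p => sum_list (fun q => fst p * (fst q * k (snd p) (snd q))) v) u).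
  - apply sum_list_ext; intros; rewrite sum_list_scal; reflexivity.
  - rewrite sum_list_exchange; apply sum_list_ext; intros.
    rewrite <- sum_list_scal; apply sum_list_ext; intros; ring.
Qed.

Lemma bform_plus {X} (k1 k2 : X -> X -> R) u v :
  bform (fun x y => k1 x y + k2 x y) u v = bform k1 u v + bform k2 u v.
Proof.
  unfold bform; rewrite <- ev_plus; apply ev_ext; intros; apply ev_plus.
Qed.

Lemma bform_scal {X} a (k : X -> X -> R) u v :
  bform (fun x y => a * k x y) u v = a * bform k u v.
Proof. unfold bform; rewrite <- ev_scal; apply ev_ext; intros; apply ev_scal. Qed.

Lemma bform_ext {X} (k1 k2 : X -> X -> R) u v :
  (forall x y, k1 x y = k2 x y) -> bform k1 u v = bform k2 u v.
Proof. intros H; apply ev_ext; intros; apply ev_ext; intros; apply H. Qed.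

Lemma ev_prod {X} (f g : X -> R) u v :
  bform (fun x y => f x * g y) u v = ev f u * ev g v.
Proof.
  unfold bform.
  transitivity (ev (fun x => ev g v * f x) u).
  - apply ev_ext; intros; rewrite ev_scal; ring.
  - rewrite ev_scal; ring.
Qed.

Lemma bform_semi_inner {X} (k : X -> X -> R) :
  psd k -> semi_inner (@app (R * X)) lscal (bform k).
Proof.
  intros [Hs Hk]; split.
  - intros u v; unfold bform; rewrite ev_exchange.
    apply ev_ext; intros y; apply ev_ext; intros x; apply Hs.
  - intros; apply ev_app.
  - intros; apply ev_lscal.
  - exact Hk.
Qed.

Lemma ev_as_bform {X} (k : X -> X -> R) x u : ev (k x) u = bform k [(1, x)] u.
Proof. unfold bform; rewrite ev_single; reflexivity. Qed.

(** The mass added at [p] brings the total coefficient to zero. *)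
Definition recenter {X : Type} (p : X) (u : list (R * X)) : list (R * X) :=
  u ++ [(- ev (fun _ => 1) u, p)].

Lemma ev_recenter {X} (p : X) (f : X -> R) u :
  ev f (recenter p u) = ev (fun x => f x - f p) u.
Proof.
  unfold recenter; rewrite ev_app.
  replace (ev f [(- ev (fun _ => 1) u, p)]) with (ev (fun _ => - f p) u)
    by (rewrite ev_const; unfold ev at 2; simpl; ring).
  unfold Rminus; rewrite ev_plus; reflexivity.
Qed.

(** ** The reproducing kernel Hilbert space *)

Definition ldist {X : Type} (k : X -> X -> R) : list (R * X) -> list (R * X) -> R :=
  sdist (@app (R * X)) lscal (bform k).

(* The completion of the space of formal combinations is realized by functions
   on [X]: a Cauchy sequence [u] is sent to [x |-> lim <delta_x, u n>]. *)
Definition rep {X : Type} (k : X -> X -> R) (u : nat -> list (R * X)) (f : X -> R) : Prop :=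
  (forall eps, 0 < eps -> exists N, forall m n, (N <= m)%nat -> (N <= n)%nat ->
     ldist k (u m) (u n) < eps) /\
  (forall x, Un_cv (fun n => ev (k x) (u n)) (f x)).

Definition rkhs {X : Type} (k : X -> X -> R) (f : X -> R) : Prop :=
  exists u, rep k u f.

(** On [rkhs] the limit does not depend on the representing sequences ([gip_spec]), so [epsilon]
    selects its only possible value. *)
Definition gip {X : Type} (k : X -> X -> R) (f g : X -> R) : R :=
  epsilon (inhabits 0) (fun r => exists u v, rep k u f /\ rep k v g /\
    Un_cv (fun n => bform k (u n) (v n)) r).

Lemma bform_sub_le {X} (k : X -> X -> R) (Hk : psd k) u v w :
  Rabs (bform k u w - bform k v w) <= ldist k u v * sqrt (bform k w w).
Proof.
  pose proof (bform_semi_inner k Hk) as HB.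
  replace (bform k u w - bform k v w) with (bform k (u ++ lscal (-1) v) w).
  - apply (si_abs_le HB).
  - rewrite (si_addl _ _ _ HB), (si_scall _ _ _ HB); ring.
Qed.

Lemma rep_bounded {X} (k : X -> X -> R) (Hk : psd k) u f : rep k u f ->
  exists M N, 0 < M /\ forall n, (N <= n)%nat -> sqrt (bform k (u n) (u n)) <= M.
Proof.
  intros [Hc _]; destruct (Hc 1 ltac:(lra)) as [N HN].
  exists (1 + sqrt (bform k (u N) (u N))), N; split.
  - pose proof (sqrt_pos (bform k (u N) (u N))); lra.
  - intros n Hn; specialize (HN n N Hn (le_n N)).
    pose proof (si_norm_le_sdist (bform_semi_inner k Hk) (u n) (u N)).
    unfold ldist in HN; lra.
Qed.

Lemma rep_bform_cv {X} (k : X -> X -> R) (Hk : psd k) u f w : rep k u f ->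
  Un_cv (fun n => bform k (u n) w) (ev f w).
Proof.
  intros [_ Hf].
  replace (fun n => bform k (u n) w) with (fun n => ev (fun x => ev (k x) (u n)) w).
  - apply sum_list_cv; intros p _.
    apply (CV_mult (fun _ => fst p) (fun n => ev (k (snd p)) (u n)));
      [apply Un_cv_const|apply Hf].
  - apply functional_extensionality; intros n.
    apply (si_sym _ _ _ (bform_semi_inner k Hk)).
Qed.

(** Shows that the limiting inner product depends on [u] only through [f]: as [u] is Cauchy and [v]
    bounded, [u n] can be replaced by its limit, uniformly against [v n]. *)
Lemma rep_ev_cv {X} (k : X -> X -> R) (Hk : psd k) u f v g r :
  rep k u f -> rep k v g ->
  Un_cv (fun n => bform k (u n) (v n)) r -> Un_cv (fun n => ev f (v n)) r.
Proof.
  intros Hu Hv Hr; apply (Un_cv_squeeze0 _ _ _ Hr); intros eps He.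
  destruct (rep_bounded k Hk v g Hv) as (M & N1 & HM & HN1).
  destruct Hu as [Hc Hf].
  destruct (Hc (eps / M)) as [N2 HN2]; [apply Rdiv_lt_0_compat; lra|].
  exists (max N1 N2); intros n Hn.
  assert (Hcv : Un_cv (fun m => Rabs (bform k (u n) (v n) - bform k (u m) (v n)))
                  (Rabs (bform k (u n) (v n) - ev f (v n)))).
  { apply cv_cvabs.
    apply (CV_minus (fun _ => bform k (u n) (v n)) (fun m => bform k (u m) (v n)));
      [apply Un_cv_const|apply rep_bform_cv; [exact Hk|split; assumption]]. }
  refine (Un_cv_le _ _ _ N2 _ Hcv).
  intros m Hm; eapply Rle_trans; [apply bform_sub_le; exact Hk|].
  specialize (HN2 n m ltac:(lia) Hm); specialize (HN1 n ltac:(lia)).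
  replace eps with (eps / M * M) by (field; lra).
  apply Rmult_le_compat; [apply sdist_nonneg|apply sqrt_pos|lra|exact HN1].
Qed.

Lemma rep_inner_cv {X} (k : X -> X -> R) (Hk : psd k) u f v g :
  rep k u f -> rep k v g -> exists r, Un_cv (fun n => bform k (u n) (v n)) r.
Proof.
  intros Hu Hv.
  assert (Hc : Cauchy_crit (fun n => bform k (u n) (v n))).
  2: { destruct (R_complete _ Hc) as [l Hl]; exists l; exact Hl. }
  intros eps He.
  destruct (rep_bounded k Hk u f Hu) as (M1 & N1 & HM1 & HN1).
  destruct (rep_bounded k Hk v g Hv) as (M2 & N2 & HM2 & HN2).
  destruct (proj1 Hu (eps / (2 * M2))) as [N3 HN3]; [apply Rdiv_lt_0_compat; lra|].
  destruct (proj1 Hv (eps / (2 * M1))) as [N4 HN4]; [apply Rdiv_lt_0_compat; lra|].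
  exists (max (max N1 N2) (max N3 N4)); intros n m Hn Hm; unfold Rdist.
  replace (bform k (u n) (v n) - bform k (u m) (v m)) with
    ((bform k (u n) (v n) - bform k (u m) (v n)) +
     (bform k (v n) (u m) - bform k (v m) (u m)))
    by (rewrite !(si_sym _ _ _ (bform_semi_inner k Hk) _ (u m)); ring).
  eapply Rle_lt_trans; [apply Rabs_triang|].
  specialize (HN3 n m ltac:(lia) ltac:(lia)); specialize (HN4 n m ltac:(lia) ltac:(lia)).
  specialize (HN1 m ltac:(lia)); specialize (HN2 n ltac:(lia)).
  pose proof (bform_sub_le k Hk (u n) (u m) (v n)) as H1.
  pose proof (bform_sub_le k Hk (v n) (v m) (u m)) as H2.
  assert (ldist k (u n) (u m) * sqrt (bform k (v n) (v n)) < eps / (2 * M2) * M2)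
    by (eapply Rle_lt_trans;
        [apply Rmult_le_compat_l; [apply sdist_nonneg|exact HN2]
        |apply Rmult_lt_compat_r; assumption]).
  assert (ldist k (v n) (v m) * sqrt (bform k (u m) (u m)) < eps / (2 * M1) * M1)
    by (eapply Rle_lt_trans;
        [apply Rmult_le_compat_l; [apply sdist_nonneg|exact HN1]
        |apply Rmult_lt_compat_r; assumption]).
  assert (eps / (2 * M2) * M2 = eps / 2) by (field; lra).
  assert (eps / (2 * M1) * M1 = eps / 2) by (field; lra).
  lra.
Qed.

Lemma gip_spec {X} (k : X -> X -> R) (Hk : psd k) u f v g :
  rep k u f -> rep k v g -> Un_cv (fun n => bform k (u n) (v n)) (gip k f g).
Proof.
  intros Hu Hv.
  pose proof (bform_semi_inner k Hk) as HB.
  destruct (rep_inner_cv k Hk u f v g Hu Hv) as [r Hr].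
  assert (He : exists u' v', rep k u' f /\ rep k v' g /\
             Un_cv (fun n => bform k (u' n) (v' n)) (gip k f g)).
  { apply (epsilon_spec (inhabits 0) (fun r => exists u v, rep k u f /\ rep k v g /\
      Un_cv (fun n => bform k (u n) (v n)) r)).
    exists r, u, v; auto. }
  destruct He as (u' & v' & Hu' & Hv' & Hr').
  replace (gip k f g) with r; [exact Hr|].
  (* Representatives are changed one at a time, through the mixed pair [u], [v']. *)
  destruct (rep_inner_cv k Hk u f v' g Hu Hv') as [r2 Hr2].
  transitivity r2.
  - assert (Hs : forall w h s, rep k w h -> Un_cv (fun n => bform k (u n) (w n)) s ->
               Un_cv (fun n => ev h (u n)) s).
    { intros w h s Hw Hs; apply (rep_ev_cv k Hk w h u f); try assumption.
      replace (fun n => bform k (w n) (u n)) with (fun n => bform k (u n) (w n));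
        [exact Hs|apply functional_extensionality; intros n; apply (si_sym _ _ _ HB)]. }
    apply (UL_sequence (fun n => ev g (u n))); eauto.
  - apply (UL_sequence (fun n => ev f (v' n))).
    + apply (rep_ev_cv k Hk u f v' g); assumption.
    + apply (rep_ev_cv k Hk u' f v' g); assumption.
Qed.

Lemma rep_add {X} (k : X -> X -> R) (Hk : psd k) u f v g : rep k u f -> rep k v g ->
  rep k (fun n => u n ++ v n) (fun x => f x + g x).
Proof.
  intros [Hu Hf] [Hv Hg]; pose proof (bform_semi_inner k Hk) as HB; split.
  - intros eps He.
    destruct (Hu (eps / 2)) as [N1 H1]; [lra|].
    destruct (Hv (eps / 2)) as [N2 H2]; [lra|].
    exists (max N1 N2); intros m n Hm Hn.
    specialize (H1 m n ltac:(lia) ltac:(lia)); specialize (H2 m n ltac:(lia) ltac:(lia)).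
    eapply Rle_lt_trans with (ldist k (u m) (u n) + ldist k (v m) (v n)); [|lra].
    unfold ldist, sdist.
    eapply Rle_trans; [|apply (si_minkowski HB (u m ++ lscal (-1) (u n)))].
    right; f_equal.
    repeat rewrite ?(si_addl _ _ _ HB), ?(si_addr HB), ?(si_scall _ _ _ HB),
      ?(si_scalr HB).
    ring.
  - intros x.
    replace (fun n => ev (k x) (u n ++ v n)) with
      (fun n => ev (k x) (u n) + ev (k x) (v n))
      by (apply functional_extensionality; intros; symmetry; apply ev_app).
    apply CV_plus; [apply Hf|apply Hg].
Qed.

Lemma rep_scal {X} (k : X -> X -> R) (Hk : psd k) a u f : rep k u f ->
  rep k (fun n => lscal a (u n)) (fun x => a * f x).
Proof.
  intros [Hu Hf]; pose proof (bform_semi_inner k Hk) as HB; split.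
  - intros eps He; pose proof (Rabs_pos a).
    destruct (Hu (eps / (Rabs a + 1))) as [N HN]; [apply Rdiv_lt_0_compat; lra|].
    exists N; intros m n Hm Hn; specialize (HN m n Hm Hn).
    replace (ldist k (lscal a (u m)) (lscal a (u n))) with (Rabs a * ldist k (u m) (u n)).
    + apply Rle_lt_trans with (Rabs a * (eps / (Rabs a + 1))).
      * apply Rmult_le_compat_l; lra.
      * replace (Rabs a * (eps / (Rabs a + 1))) with (eps - eps / (Rabs a + 1))
          by (field; lra).
        assert (0 < eps / (Rabs a + 1)) by (apply Rdiv_lt_0_compat; lra); lra.
    + rewrite <- (sqrt_Rsqr_abs a); unfold ldist, sdist.
      rewrite <- sqrt_mult by (try apply (si_nonneg _ _ _ HB); apply Rle_0_sqr).
      f_equal; unfold Rsqr.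
      repeat rewrite ?(si_addl _ _ _ HB), ?(si_addr HB), ?(si_scall _ _ _ HB),
        ?(si_scalr HB).
      ring.
  - intros x.
    replace (fun n => ev (k x) (lscal a (u n))) with (fun n => a * ev (k x) (u n))
      by (apply functional_extensionality; intros; symmetry; apply ev_lscal).
    apply (CV_mult (fun _ => a)); [apply Un_cv_const|apply Hf].
Qed.

Lemma rep_const {X} (k : X -> X -> R) (Hk : psd k) w :
  rep k (fun _ => w) (fun x => ev (k x) w).
Proof.
  pose proof (bform_semi_inner k Hk) as HB; split.
  - intros eps He; exists 0%nat; intros m n _ _.
    unfold ldist, sdist; rewrite (si_comb HB).
    replace (_ + _ + _) with 0 by ring; rewrite sqrt_0; exact He.
  - intros x; apply Un_cv_const.
Qed.

Lemma gip_sym {X} (k : X -> X -> R) (Hk : psd k) f g : rkhs k f -> rkhs k g ->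
  gip k f g = gip k g f.
Proof.
  intros [u Hu] [v Hv].
  apply (UL_sequence (fun n => bform k (u n) (v n))); [apply gip_spec; assumption|].
  replace (fun n => bform k (u n) (v n)) with (fun n => bform k (v n) (u n));
    [apply gip_spec; assumption|].
  apply functional_extensionality; intros n; apply (si_sym _ _ _ (bform_semi_inner k Hk)).
Qed.

Lemma gip_addl {X} (k : X -> X -> R) (Hk : psd k) f g h :
  rkhs k f -> rkhs k g -> rkhs k h ->
  gip k (fun x => f x + g x) h = gip k f h + gip k g h.
Proof.
  intros [u Hu] [v Hv] [w Hw].
  apply (UL_sequence (fun n => bform k (u n ++ v n) (w n))).
  - apply (gip_spec k Hk (fun n => u n ++ v n)); [apply rep_add|]; assumption.
  - replace (fun n => bform k (u n ++ v n) (w n)) with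
      (fun n => bform k (u n) (w n) + bform k (v n) (w n))
      by (apply functional_extensionality; intros; symmetry; apply ev_app).
    apply CV_plus; apply gip_spec; assumption.
Qed.

Lemma gip_scall {X} (k : X -> X -> R) (Hk : psd k) a f g :
  rkhs k f -> rkhs k g -> gip k (fun x => a * f x) g = a * gip k f g.
Proof.
  intros [u Hu] [v Hv].
  apply (UL_sequence (fun n => bform k (lscal a (u n)) (v n))).
  - apply (gip_spec k Hk (fun n => lscal a (u n))); [apply rep_scal|]; assumption.
  - replace (fun n => bform k (lscal a (u n)) (v n)) with
      (fun n => a * bform k (u n) (v n))
      by (apply functional_extensionality; intros; symmetry; apply ev_lscal).
    apply (CV_mult (fun _ => a)); [apply Un_cv_const|apply gip_spec; assumption].
Qed.

Lemma gip_nonneg {X} (k : X -> X -> R) (Hk : psd k) f : rkhs k f -> 0 <= gip k f f.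
Proof.
  intros [u Hu]; apply (Un_cv_ge (fun n => bform k (u n) (u n)) _ _ 0).
  - intros n _; apply Hk.
  - apply gip_spec; assumption.
Qed.

Lemma gip_const {X} (k : X -> X -> R) (Hk : psd k) u v :
  gip k (fun x => ev (k x) u) (fun x => ev (k x) v) = bform k u v.
Proof.
  apply (UL_sequence (fun n => bform k u v)); [|apply Un_cv_const].
  apply (gip_spec k Hk (fun _ => u) _ (fun _ => v)); apply rep_const; exact Hk.
Qed.

Lemma gip_reproducing {X} (k : X -> X -> R) (Hk : psd k) f x : rkhs k f ->
  gip k (fun y => k y x) f = f x.
Proof.
  intros [u Hu].
  apply (UL_sequence (fun n => bform k [(1, x)] (u n))).
  - apply (gip_spec k Hk (fun _ => [(1, x)])); [|exact Hu].
    replace (fun y => k y x) with (fun y => ev (k y) [(1, x)])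
      by (apply functional_extensionality; intros; apply ev_single).
    apply rep_const; exact Hk.
  - replace (fun n => bform k [(1, x)] (u n)) with (fun n => ev (k x) (u n))
      by (apply functional_extensionality; intros; apply ev_as_bform).
    apply Hu.
Qed.

(** Vectors are genuine functions, so equality in the completion is pointwise equality and
    combinations of norm zero become the zero function. *)
Definition rkhs_car {X : Type} (k : X -> X -> R) : Type := {f : X -> R | rkhs k f}.

Lemma rkhs_eq {X} (k : X -> X -> R) (f g : rkhs_car k) :
  (forall x, proj1_sig f x = proj1_sig g x) -> f = g.
Proof.
  intros H; destruct f as [f Hf], g as [g Hg]; simpl in H.
  apply functional_extensionality in H; subst g.
  f_equal; apply proof_irrelevance.
Qed.

Lemma rkhs_add {X} (k : X -> X -> R) (Hk : psd k) f g : rkhs k f -> rkhs k g ->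
  rkhs k (fun x => f x + g x).
Proof. intros [u Hu] [v Hv]; eexists; apply rep_add; eassumption. Qed.

Lemma rkhs_scal {X} (k : X -> X -> R) (Hk : psd k) a f : rkhs k f ->
  rkhs k (fun x => a * f x).
Proof. intros [u Hu]; eexists; apply rep_scal; eassumption. Qed.

Lemma rkhs_comb {X} (k : X -> X -> R) (Hk : psd k) u : rkhs k (fun x => ev (k x) u).
Proof. eexists; apply rep_const; exact Hk. Qed.

Definition radd {X : Type} (k : X -> X -> R) (Hk : psd k) (f g : rkhs_car k) : rkhs_car k :=
  exist _ (fun x => proj1_sig f x + proj1_sig g x)
    (rkhs_add k Hk _ _ (proj2_sig f) (proj2_sig g)).

Definition rscal {X : Type} (k : X -> X -> R) (Hk : psd k) a (f : rkhs_car k) : rkhs_car k :=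
  exist _ (fun x => a * proj1_sig f x) (rkhs_scal k Hk a _ (proj2_sig f)).

Definition rinner {X : Type} (k : X -> X -> R) (f g : rkhs_car k) : R :=
  gip k (proj1_sig f) (proj1_sig g).

Definition rcomb {X : Type} (k : X -> X -> R) (Hk : psd k) (u : list (R * X)) : rkhs_car k :=
  exist _ (fun x => ev (k x) u) (rkhs_comb k Hk u).

Lemma rkhs_semi_inner {X} (k : X -> X -> R) (Hk : psd k) :
  semi_inner (radd k Hk) (rscal k Hk) (rinner k).
Proof.
  split.
  - intros [f Hf] [g Hg]; apply gip_sym; assumption.
  - intros [f Hf] [g Hg] [h Hh]; apply gip_addl; assumption.
  - intros a [f Hf] [g Hg]; apply gip_scall; assumption.
  - intros [f Hf]; apply gip_nonneg; assumption.
Qed.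

(** Cauchy-Schwarz and the reproducing property give [f x ^ 2 <= k x x * |f|^2], so a vector of norm
    zero vanishes at every point. *)
Lemma rinner_def {X} (k : X -> X -> R) (Hk : psd k) (f : rkhs_car k) :
  rinner k f f = 0 -> f = rcomb k Hk [].
Proof.
  intros H0; apply rkhs_eq; intros x; simpl.
  replace (ev (k x) []) with 0 by reflexivity.
  rewrite <- (gip_reproducing k Hk _ x (proj2_sig f)).
  pose proof (si_cauchy_schwarz (rkhs_semi_inner k Hk) (rcomb k Hk [(1, x)]) f) as HC.
  rewrite H0 in HC; unfold rinner, rcomb in HC; cbn [proj1_sig] in HC.
  replace (fun y => ev (k y) [(1, x)]) with (fun y => k y x) in HC
    by (apply functional_extensionality; intros; symmetry; apply ev_single).
  apply Rsqr_0_uniq, Rle_antisym; [unfold Rsqr; lra|apply Rle_0_sqr].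
Qed.

Lemma rdist_comb {X} (k : X -> X -> R) (Hk : psd k) u v :
  sdist (radd k Hk) (rscal k Hk) (rinner k) (rcomb k Hk u) (rcomb k Hk v) = ldist k u v.
Proof.
  unfold ldist, sdist.
  rewrite (si_comb (rkhs_semi_inner k Hk)), (si_comb (bform_semi_inner k Hk)).
  unfold rinner; simpl; rewrite !gip_const by exact Hk; reflexivity.
Qed.

Lemma rdist_rep_le {X} (k : X -> X -> R) (Hk : psd k) (f : rkhs_car k) u w eps N :
  rep k u (proj1_sig f) -> 0 <= eps ->
  (forall n, (N <= n)%nat -> ldist k (u n) w <= eps) ->
  sdist (radd k Hk) (rscal k Hk) (rinner k) f (rcomb k Hk w) <= eps.
Proof.
  intros Hu He HN; apply sqrt_le_of_sq; [exact He|].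
  pose proof (bform_semi_inner k Hk) as HB.
  apply (Un_cv_le (fun n => bform k (u n ++ lscal (-1) w) (u n ++ lscal (-1) w)) _ _ N).
  - intros n Hn; specialize (HN n Hn); unfold ldist, sdist in HN.
    rewrite <- (sqrt_sqrt (bform _ _ _)) by apply (si_nonneg _ _ _ HB).
    apply Rmult_le_compat; try apply sqrt_pos; assumption.
  - assert (Hr : rep k (fun n => u n ++ lscal (-1) w)
               (fun x => proj1_sig f x + -1 * ev (k x) w)).
    { apply (rep_add k Hk u _ (fun _ => lscal (-1) w)); [exact Hu|].
      apply (rep_scal k Hk (-1) (fun _ => w)); apply rep_const; exact Hk. }
    exact (gip_spec k Hk _ _ _ _ Hr Hr).
Qed.

Lemma rkhs_dense {X} (k : X -> X -> R) (Hk : psd k) (f : rkhs_car k) eps : 0 < eps ->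
  exists w, sdist (radd k Hk) (rscal k Hk) (rinner k) f (rcomb k Hk w) <= eps.
Proof.
  intros He; destruct (proj2_sig f) as [u Hu].
  destruct (proj1 Hu eps He) as [N HN]; exists (u N).
  apply (rdist_rep_le k Hk f u (u N) eps N Hu); [lra|].
  intros n Hn; left; apply HN; lia.
Qed.

(** Each [F n] is approximated by a combination [w n] at distance at most [1 / (n + 1)]. The
    sequence [w] is Cauchy, hence represents a function, and this function is the limit of [F]. *)
Lemma rkhs_complete {X} (k : X -> X -> R) (Hk : psd k) (F : nat -> rkhs_car k) :
  let d := sdist (radd k Hk) (rscal k Hk) (rinner k) in
  (forall eps, 0 < eps -> exists N, forall m n, (N <= m)%nat -> (N <= n)%nat ->
     d (F m) (F n) < eps) ->
  exists l, forall eps, 0 < eps -> exists N, forall n, (N <= n)%nat -> d (F n) l < eps.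
Proof.
  intros d HF.
  pose proof (rkhs_semi_inner k Hk) as HR.
  destruct (choice (fun n w => d (F n) (rcomb k Hk w) <= / (INR n + 1))) as [w Hw].
  { intros n; apply rkhs_dense, inv_INR_pos. }
  assert (Hc : forall eps, 0 < eps -> exists N, forall m n, (N <= m)%nat -> (N <= n)%nat ->
     ldist k (w m) (w n) < eps).
  { intros eps He.
    destruct (HF (eps / 3)) as [N1 H1]; [lra|].
    destruct (inv_INR_small (eps / 3)) as [N2 H2]; [lra|].
    exists (max N1 N2); intros m n Hm Hn.
    specialize (H1 m n ltac:(lia) ltac:(lia)).
    pose proof (H2 m ltac:(lia)); pose proof (H2 n ltac:(lia)).
    pose proof (Hw m); pose proof (Hw n).
    rewrite <- (rdist_comb k Hk).
    pose proof (sdist_triangle HR (rcomb k Hk (w m)) (F m) (rcomb k Hk (w n))).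
    pose proof (sdist_triangle HR (F m) (F n) (rcomb k Hk (w n))).
    pose proof (sdist_sym HR (rcomb k Hk (w m)) (F m)).
    unfold d in *; lra. }
  destruct (choice (fun x r => Un_cv (fun n => ev (k x) (w n)) r)) as [f Hf].
  { intros x.
    (* Evaluation at [x] is pairing with [delta_x], hence Lipschitz for [ldist]. *)
    assert (HC : Cauchy_crit (fun n => ev (k x) (w n))).
    2: { destruct (R_complete _ HC) as [l Hl]; exists l; exact Hl. }
    intros eps He; set (M := sqrt (bform k [(1, x)] [(1, x)])).
    pose proof (sqrt_pos (bform k [(1, x)] [(1, x)])) as HM; fold M in HM.
    destruct (Hc (eps / (M + 1))) as [N HN]; [apply Rdiv_lt_0_compat; lra|].
    exists N; intros n m Hn Hm; specialize (HN n m Hn Hm); unfold Rdist.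
    rewrite !ev_as_bform, !(si_sym _ _ _ (bform_semi_inner k Hk) [(1, x)]).
    eapply Rle_lt_trans; [apply bform_sub_le; exact Hk|]; fold M.
    apply Rle_lt_trans with (eps / (M + 1) * M).
    - apply Rmult_le_compat_r; lra.
    - replace (eps / (M + 1) * M) with (eps - eps / (M + 1)) by (field; lra).
      assert (0 < eps / (M + 1)) by (apply Rdiv_lt_0_compat; lra); lra. }
  assert (Hr : rep k w f) by (split; assumption).
  pose (l := exist _ f (ex_intro _ w Hr) : rkhs_car k).
  exists l; intros eps He.
  destruct (Hc (eps / 3)) as [N1 H1]; [lra|].
  destruct (inv_INR_small (eps / 3)) as [N2 H2]; [lra|].
  exists (max N1 N2); intros n Hn.
  assert (Hl : d l (rcomb k Hk (w n)) <= eps / 3).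
  { apply (rdist_rep_le k Hk _ w _ _ N1); [exact Hr|lra|].
    intros m Hm; left; apply H1; lia. }
  specialize (H2 n ltac:(lia)); specialize (Hw n).
  pose proof (sdist_triangle HR (F n) (rcomb k Hk (w n)) l) as Ht.
  rewrite (sdist_sym HR (rcomb k Hk (w n))) in Ht.
  unfold d in *; lra.
Qed.

Definition rkhs_space {X : Type} (k : X -> X -> R) (Hk : psd k) : HilbertSpace.
Proof.
  refine {| hcar := rkhs_car k; hadd := radd k Hk; hzero := rcomb k Hk [];
            hopp := rscal k Hk (-1); hscal := rscal k Hk; hinner := rinner k;
            hinner_sym := si_sym _ _ _ (rkhs_semi_inner k Hk);
            hinner_addl := si_addl _ _ _ (rkhs_semi_inner k Hk);
            hinner_scall := si_scall _ _ _ (rkhs_semi_inner k Hk);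
            hinner_nonneg := si_nonneg _ _ _ (rkhs_semi_inner k Hk);
            hinner_def := rinner_def k Hk;
            hcomplete := rkhs_complete k Hk |};
  intros; apply rkhs_eq; intros; simpl; unfold ev; simpl; ring.
Defined.

(** ** Squares of Hilbert lengths *)

Lemma ginv_unique {G : Group} (a b : G) : gmul a b = gone -> b = ginv a.
Proof.
  intros H; rewrite <- (gmul_1l G b), <- (gmul_Vl G a), <- gmul_assoc, H.
  apply gmul_1r.
Qed.

Lemma ginv_mul {G : Group} (a b : G) : ginv (gmul a b) = gmul (ginv b) (ginv a).
Proof.
  symmetry; apply ginv_unique.
  rewrite gmul_assoc, <- (gmul_assoc G a b), gmul_Vr, gmul_1r; apply gmul_Vr.
Qed.

Lemma ginv_inv {G : Group} (a : G) : ginv (ginv a) = a.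
Proof. symmetry; apply ginv_unique, gmul_Vl. Qed.

Lemma ginv_one {G : Group} : ginv (@gone G) = gone.
Proof. symmetry; apply ginv_unique, gmul_1l. Qed.

(* If [psi x = |F x - F 1|^2] for an equivariant [F], this is the Gram kernel
   [<F x - F 1, F y - F 1>]. *)
Definition gker {G : Group} (psi : G -> R) (x y : G) : R :=
  (psi x + psi y - psi (gmul (ginv x) y)) / 2.

(** This is negative type, also called conditional negative definiteness. Positivity of [gker psi]
    is the usual condition on combinations of total weight zero, rewritten with base point
    [gone]. *)
Definition cnd {G : Group} (psi : G -> R) : Prop :=
  psi gone = 0 /\ (forall g, psi (ginv g) = psi g) /\ psd (gker psi).

Lemma gker_diag {G : Group} (psi : G -> R) x : psi gone = 0 -> gker psi x x = psi x.
Proof. intros H; unfold gker; rewrite gmul_Vl, H; lra. Qed.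

Lemma cnd_nonneg {G : Group} (psi : G -> R) g : cnd psi -> 0 <= psi g.
Proof.
  intros (H1 & _ & _ & Hp); specialize (Hp [(1, g)]).
  unfold bform in Hp; rewrite !ev_single, gker_diag in Hp; assumption.
Qed.

(** The form at [u] is [B s s] for the vector [s] obtained by summing the [c P x] over [u]. *)
Lemma psd_gram {X T : Type} add scal (B : T -> T -> R) (P : X -> T) :
  semi_inner add scal B -> psd (fun x y => B (P x) (P y)).
Proof.
  intros HB; split; [intros; apply (si_sym _ _ _ HB)|intros u].
  (* [T] comes without a zero; a nonempty combination provides [scal 0 (P x0)] for that role. *)
  destruct u as [|[c0 x0] u0]; [unfold bform, ev; simpl; lra|].
  set (u := (c0, x0) :: u0).
  set (s := fold_right (fun p acc => add (scal (fst p) (P (snd p))) acc) (scal 0 (P x0)) u).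
  assert (Hs : forall y, ev (fun x => B (P x) y) u = B s y).
  { intros y; unfold s; induction u as [|p v IH]; simpl.
    - rewrite (si_scall _ _ _ HB); unfold ev; simpl; ring.
    - rewrite (si_addl _ _ _ HB), (si_scall _ _ _ HB), <- IH; reflexivity. }
  replace (bform (fun x y => B (P x) (P y)) u u) with (B s s);
    [apply (si_nonneg _ _ _ HB)|].
  unfold bform; rewrite <- Hs; apply ev_ext; intros x.
  rewrite (si_sym _ _ _ HB), <- Hs; apply ev_ext; intros y; apply (si_sym _ _ _ HB).
Qed.

Lemma hilbert_semi_inner (H : HilbertSpace) : semi_inner (hadd H) (hscal H) (hinner H).
Proof. split; [apply hinner_sym|apply hinner_addl|apply hinner_scall|apply hinner_nonneg]. Qed.

Lemma hscal_0 (H : HilbertSpace) (x : H) : hscal H 0 x = hzero H.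
Proof.
  rewrite <- (hadd_0l H (hscal H 0 x)), hadd_comm, <- (hadd_oppr H (hscal H 0 x)).
  rewrite hadd_assoc, <- hscal_addl, Rplus_0_l; reflexivity.
Qed.

Lemma hopp_scal (H : HilbertSpace) (x : H) : hopp H x = hscal H (-1) x.
Proof.
  rewrite <- (hadd_0l H (hscal H (-1) x)), <- (hadd_oppr H x), (hadd_comm H x).
  rewrite <- hadd_assoc, <- (hscal_1 H x) at 1.
  rewrite <- hscal_1 with (x := x) at 3.
  rewrite <- hscal_addl; replace (1 + -1) with 0 by ring.
  rewrite hscal_0, hscal_1, hadd_comm, hadd_0l; reflexivity.
Qed.

Lemma hdist_sdist (H : HilbertSpace) (x y : H) :
  hdist H x y = sdist (hadd H) (hscal H) (hinner H) x y.
Proof. unfold hdist, sdist; rewrite hopp_scal; reflexivity. Qed.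

Lemma hdist_sq (H : HilbertSpace) (x y : H) :
  hdist H x y ^ 2 = hinner H x x - 2 * hinner H x y + hinner H y y.
Proof.
  pose proof (hilbert_semi_inner H) as HB; rewrite hdist_sdist; unfold sdist.
  rewrite pow2_sqrt by apply hinner_nonneg; rewrite (si_comb HB); ring.
Qed.

Lemma hdist_nonneg (H : HilbertSpace) (x y : H) : 0 <= hdist H x y.
Proof. apply sqrt_pos. Qed.

Lemma hdist_sym (H : HilbertSpace) (x y : H) : hdist H x y = hdist H y x.
Proof. rewrite !hdist_sdist; apply (sdist_sym (hilbert_semi_inner H)). Qed.

Lemma hdist_triangle (H : HilbertSpace) (x y z : H) :
  hdist H x z <= hdist H x y + hdist H y z.
Proof. rewrite !hdist_sdist; apply (sdist_triangle (hilbert_semi_inner H)). Qed.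

Lemma hdist_refl (H : HilbertSpace) (x : H) : hdist H x x = 0.
Proof.
  unfold hdist; rewrite hadd_oppr, <- (hscal_0 H x), hinner_scall, Rmult_0_l.
  apply sqrt_0.
Qed.

(** Invariance gives [L (x^-1 y) = |F x - F y|], and polarization then identifies [gker] with the
    Gram kernel of [F x - F 1]. *)
Lemma hilbert_length_cnd {G : Group} (L : G -> R) :
  hilbert_length G L -> cnd (fun g => L g ^ 2).
Proof.
  intros (H & F & HF & HL).
  assert (Hd : forall x y, L (gmul (ginv x) y) = hdist H (F x) (F y)).
  { intros x y; rewrite HL, hdist_sym, <- (HF _ _ x), gmul_1r, gmul_assoc, gmul_Vr, gmul_1l.
    reflexivity. }
  split; [|split].
  - rewrite HL, hdist_refl; ring.
  - intros g; f_equal; rewrite <- (gmul_1r G (ginv g)), Hd, HL; reflexivity.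
  - pose proof (hilbert_semi_inner H) as HB.
    pose proof (psd_gram _ _ _ (fun x => hadd H (F x) (hscal H (-1) (F gone))) HB) as Hg.
    replace (gker (fun g => L g ^ 2)) with
      (fun x y => hinner H (hadd H (F x) (hscal H (-1) (F gone)))
                           (hadd H (F y) (hscal H (-1) (F gone)))); [exact Hg|].
    apply functional_extensionality; intros x; apply functional_extensionality; intros y.
    unfold gker; rewrite Hd, !HL, !hdist_sq.
    repeat rewrite ?(si_addl _ _ _ HB), ?(si_addr HB), ?(si_scall _ _ _ HB),
      ?(si_scalr HB).
    rewrite (hinner_sym H (F gone) (F y)); field.
Qed.

Lemma ldist_gker {G : Group} (psi : G -> R) (Hp : cnd psi) g h :
  ldist (gker psi) [(1, g)] [(1, h)] = sqrt (psi (gmul (ginv g) h)).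
Proof.
  destruct Hp as (H1 & _ & Hk).
  unfold ldist, sdist; rewrite (si_comb (bform_semi_inner _ Hk)).
  unfold bform; rewrite !ev_single, !(gker_diag psi) by exact H1.
  unfold gker; f_equal; field.
Qed.

(** GNS construction: [F g] is the vector of [delta_g], and the squared distance from [F g] to [F h]
    is [psi (g^-1 h)], which is left-invariant. *)
Lemma cnd_hilbert_length {G : Group} (psi : G -> R) :
  cnd psi -> hilbert_length G (fun g => sqrt (psi g)).
Proof.
  intros Hp; pose proof (proj2 (proj2 Hp)) as Hk.
  assert (Hd : forall g h, hdist (rkhs_space _ Hk) (rcomb _ Hk [(1, g)]) (rcomb _ Hk [(1, h)])
               = sqrt (psi (gmul (ginv g) h))).
  { intros g h; rewrite <- (ldist_gker psi Hp); apply (rdist_comb (gker psi) Hk). }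
  exists (rkhs_space _ Hk), (fun g => rcomb _ Hk [(1, g)]); split.
  - intros g g' h; rewrite !Hd, ginv_mul, <- gmul_assoc, (gmul_assoc G (ginv h)), gmul_Vl, gmul_1l.
    reflexivity.
  - intros g; rewrite Hd, gmul_1r, (proj1 (proj2 Hp)); reflexivity.
Qed.

(** ** Proper functions of negative type and affine actions *)

Lemma gker_one {G : Group} (psi : G -> R) y : cnd psi -> gker psi gone y = 0.
Proof.
  intros (H1 & H2 & _); unfold gker; rewrite ginv_one, gmul_1l, H1; lra.
Qed.

(** The left side is the function of [ltrans h delta_x] at [y], the right side is [ftrans h] of the
    function of [delta_x]. The same formula gives the cocycle identity of the action. *)
Lemma gker_cocycle {G : Group} (psi : G -> R) h x y : cnd psi ->
  gker psi y (gmul h x) - gker psi y h =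
  gker psi (gmul (ginv h) y) x - gker psi (ginv h) x.
Proof.
  intros (H1 & H2 & _); unfold gker.
  rewrite ginv_mul, ginv_inv, <- (H2 (gmul (ginv h) y)), ginv_mul, ginv_inv, H2.
  rewrite gmul_assoc; lra.
Qed.

(** Expansion of [<F (h x) - F h, F (h y) - F h> = <F x, F y>], by which [ltrans h] preserves the
    form. *)
Lemma gker_invariant {G : Group} (psi : G -> R) h x y : cnd psi ->
  (gker psi (gmul h x) (gmul h y) - gker psi (gmul h x) h) -
  (gker psi h (gmul h y) - gker psi h h) = gker psi x y.
Proof.
  intros (H1 & H2 & _); unfold gker.
  rewrite !ginv_mul, <- !(gmul_assoc G (ginv x)), !(gmul_assoc G (ginv h)), gmul_Vl,
    !gmul_1l, gmul_1r, H1, H2.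
  lra.
Qed.

(* The linear part of the action: [F x |-> F (h x) - F h], where [F 1 = 0]. *)
Definition ltrans {G : Group} (h : G) (u : list (R * G)) : list (R * G) :=
  recenter h (map (fun p => (fst p, gmul h (snd p))) u).

Lemma ev_ltrans {G : Group} (h : G) (f : G -> R) u :
  ev f (ltrans h u) = ev (fun x => f (gmul h x) - f h) u.
Proof.
  unfold ltrans; rewrite ev_recenter.
  unfold ev; rewrite sum_list_map; reflexivity.
Qed.

Lemma bform_ltrans {G : Group} (psi : G -> R) (Hp : cnd psi) h u v :
  bform (gker psi) (ltrans h u) (ltrans h v) = bform (gker psi) u v.
Proof.
  unfold bform; rewrite ev_ltrans; apply ev_ext; intros x.
  rewrite !ev_ltrans; unfold Rminus at 1.
  replace (- ev (fun y => gker psi h (gmul h y) - gker psi h h) v) with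
    (ev (fun y => -1 * (gker psi h (gmul h y) - gker psi h h)) v) by (rewrite ev_scal; ring).
  rewrite <- ev_plus; apply ev_ext; intros y.
  rewrite <- (gker_invariant psi h x y Hp); ring.
Qed.

(** Counterpart of [ltrans h] on represented functions. Subtracting [f (ginv h)] makes the value at
    [gone] zero, as for every vector of the space ([rkhs_one]). *)
Definition ftrans {G : Group} (h : G) (f : G -> R) (y : G) : R :=
  f (gmul (ginv h) y) - f (ginv h).

Lemma rep_ltrans {G : Group} (psi : G -> R) (Hp : cnd psi) h u f :
  rep (gker psi) u f -> rep (gker psi) (fun n => ltrans h (u n)) (ftrans h f).
Proof.
  intros [Hc Hf]; pose proof (bform_semi_inner _ (proj2 (proj2 Hp))) as HB; split.
  - intros eps He; destruct (Hc eps He) as [N HN]; exists N; intros m n Hm Hn.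
    specialize (HN m n Hm Hn); unfold ldist, sdist in *.
    rewrite (si_comb HB) in *; rewrite !bform_ltrans; assumption.
  - intros y.
    replace (fun n => ev (gker psi y) (ltrans h (u n))) with
      (fun n => ev (gker psi (gmul (ginv h) y)) (u n) - ev (gker psi (ginv h)) (u n)).
    + apply CV_minus; apply Hf.
    + apply functional_extensionality; intros n; rewrite ev_ltrans.
      unfold Rminus at 1.
      replace (- ev (gker psi (ginv h)) (u n)) with
        (ev (fun x => -1 * gker psi (ginv h) x) (u n)) by (rewrite ev_scal; ring).
      rewrite <- ev_plus; apply ev_ext; intros x.
      rewrite gker_cocycle by exact Hp; ring.
Qed.

Lemma rkhs_ftrans {G : Group} (psi : G -> R) (Hp : cnd psi) h f :
  rkhs (gker psi) f -> rkhs (gker psi) (ftrans h f).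
Proof. intros [u Hu]; eexists; apply (rep_ltrans psi Hp); exact Hu. Qed.

Lemma gip_ftrans {G : Group} (psi : G -> R) (Hp : cnd psi) h f : rkhs (gker psi) f ->
  gip (gker psi) (ftrans h f) (ftrans h f) = gip (gker psi) f f.
Proof.
  intros [u Hu]; pose proof (proj2 (proj2 Hp)) as Hk.
  pose proof (rep_ltrans psi Hp h u f Hu) as Hu'.
  apply (UL_sequence (fun n => bform (gker psi) (u n) (u n))).
  - replace (fun n => bform (gker psi) (u n) (u n)) with
      (fun n => bform (gker psi) (ltrans h (u n)) (ltrans h (u n)))
      by (apply functional_extensionality; intros; apply bform_ltrans; exact Hp).
    exact (gip_spec _ Hk _ _ _ _ Hu' Hu').
  - apply gip_spec; assumption.
Qed.

(** Linear part [ftrans h] plus the vector of [delta_h], so that the orbit map of zero is the GNS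
    map. *)
Definition gact {G : Group} (psi : G -> R) (Hp : cnd psi) (h : G)
    (f : rkhs_car (gker psi)) : rkhs_car (gker psi) :=
  exist _ (fun y => ftrans h (proj1_sig f) y + ev (gker psi y) [(1, h)])
    (rkhs_add _ (proj2 (proj2 Hp)) _ _ (rkhs_ftrans psi Hp h _ (proj2_sig f))
       (rkhs_comb _ (proj2 (proj2 Hp)) [(1, h)])).

(** [delta_1] is the zero vector, since [gker psi gone] vanishes. This makes the identity of the
    group act trivially. *)
Lemma rkhs_one {G : Group} (psi : G -> R) (Hp : cnd psi) f :
  rkhs (gker psi) f -> f gone = 0.
Proof.
  intros [u [_ Hu]]; apply (UL_sequence _ _ _ (Hu gone)).
  replace (fun n => ev (gker psi gone) (u n)) with (fun _ : nat => 0).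
  - apply Un_cv_const.
  - apply functional_extensionality; intros n.
    transitivity (ev (fun _ : G => 0) (u n)).
    + rewrite ev_const; ring.
    + apply ev_ext; intros x; symmetry; apply gker_one; exact Hp.
Qed.

Lemma gact_affine_isometric {G : Group} (psi : G -> R) (Hp : cnd psi) :
  affine_isometric_action G (rkhs_space (gker psi) (proj2 (proj2 Hp))) (gact psi Hp).
Proof.
  set (Hk := proj2 (proj2 Hp)).
  split; [|split; [|split]].
  - intros f; apply rkhs_eq; intros y; unfold gact, ftrans; cbn [proj1_sig].
    rewrite ev_single, ginv_one, gmul_1l, (rkhs_one psi Hp _ (proj2_sig f)).
    rewrite (proj1 Hk), (gker_one psi y Hp); ring.
  - intros g h f; apply rkhs_eq; intros y; unfold gact, ftrans; cbn [proj1_sig].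
    rewrite !ev_single, ginv_mul, <- gmul_assoc.
    pose proof (gker_cocycle psi g h y Hp); lra.
  - intros h f g; unfold hdist; f_equal.
    (* The translation part cancels in a difference, leaving [ftrans h] of [f - g], and [ftrans h]
       preserves the norm. *)
    etransitivity;
      [|exact (gip_ftrans psi Hp h _ (proj2_sig (radd _ Hk f (rscal _ Hk (-1) g))))].
    cbn [hinner rkhs_space]; unfold rinner.
    f_equal; apply functional_extensionality; intros y;
      cbn [hadd hopp rkhs_space proj1_sig radd rscal gact]; unfold ftrans;
      cbn [proj1_sig radd rscal]; ring.
  - intros h t f g; apply rkhs_eq; intros y.
    cbn; unfold gact, ftrans; cbn [proj1_sig radd rscal]; ring.
Qed.

Lemma cnd_proper_haagerup {G : Group} (psi : G -> R) :
  cnd psi -> (forall r, finite_pred (fun g => psi g <= r)) -> haagerup G.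
Proof.
  intros Hp Hproper; set (Hk := proj2 (proj2 Hp)).
  set (H := rkhs_space (gker psi) Hk).
  pose proof (gact_affine_isometric psi Hp) as Ha.
  exists H, (gact psi Hp); split; [exact Ha|].
  destruct Ha as (_ & _ & Hiso & _); fold Hk H in Hiso.
  intros x r.
  (* Bound on the norm of [g 0] along the chain [g 0], [g x], [g y], [x], [0], whose steps have
     length at most [|x|], [r], [r], [|x|]. *)
  set (M := 2 * r + 2 * hdist H x (hzero H)).
  destruct (Hproper (M * M)) as [l Hl]; exists l; intros g (y & Hy & Hgy); apply Hl.
  assert (Ho : hdist H (gact psi Hp g (hzero H)) (hzero H) = sqrt (psi g)).
  { rewrite <- (proj1 (proj2 Hp) g), <- (gmul_1r G (ginv g)), <- (ldist_gker psi Hp).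
    rewrite <- (rdist_comb _ Hk).
    replace (gact psi Hp g (hzero H)) with (rcomb _ Hk [(1, g)] : H).
    - replace (hzero H) with (rcomb _ Hk [(1, gone)] : H); [reflexivity|].
      apply rkhs_eq; intros z.
      change (ev (gker psi z) [(1, gone)] = ev (gker psi z) []).
      rewrite ev_single, (proj1 Hk), gker_one by exact Hp.
      reflexivity.
    - apply rkhs_eq; intros z.
      change (ev (gker psi z) [(1, g)] =
        ftrans g (fun y => ev (gker psi y) []) z + ev (gker psi z) [(1, g)]).
      unfold ftrans.
      replace (ev (gker psi (gmul (ginv g) z)) []) with 0 by reflexivity.
      replace (ev (gker psi (ginv g)) []) with 0 by reflexivity.
      ring. }
  assert (Hs : sqrt (psi g) <= M).
  { rewrite <- Ho.
    pose proof (hdist_triangle H (gact psi Hp g (hzero H)) (gact psi Hp g x) (hzero H)).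
    pose proof (hdist_triangle H (gact psi Hp g x) (gact psi Hp g y) (hzero H)).
    pose proof (hdist_triangle H (gact psi Hp g y) x (hzero H)).
    rewrite !Hiso in *.
    pose proof (hdist_sym H x y); pose proof (hdist_sym H x (hzero H)).
    unfold M; lra. }
  pose proof (sqrt_pos (psi g)).
  rewrite <- (sqrt_sqrt (psi g)) by (apply cnd_nonneg; exact Hp).
  apply Rmult_le_compat; assumption.
Qed.

(** ** Affine actions with a point fixed by a finite subgroup *)

Lemma finite_pred_exact {T : Type} (P : T -> Prop) :
  finite_pred P -> exists l, NoDup l /\ forall x, In x l <-> P x.
Proof.
  intros [l Hl].
  exists (nodup (fun x y => excluded_middle_informative (x = y))
            (filter (fun x => if excluded_middle_informative (P x) then true else false) l)).
  split; [apply NoDup_nodup|].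
  intros x; rewrite nodup_In, filter_In.
  destruct (excluded_middle_informative (P x)) as [Hx|Hx]; split; auto.
  intros [_ Hf]; discriminate.
Qed.

(* Averages are built from binary affine combinations, the only ones an affine
   action is assumed to preserve. *)
Fixpoint havg (H : HilbertSpace) (l : list H) : H :=
  match l with
  | [] => hzero H
  | x :: l' => hadd H (hscal H (/ INR (S (length l'))) x)
                      (hscal H (1 - / INR (S (length l'))) (havg H l'))
  end.

Lemma havg_sum (H : HilbertSpace) (l : list H) :
  hscal H (INR (length l)) (havg H l) = fold_right (hadd H) (hzero H) l.
Proof.
  induction l as [|x l IH]; cbn [length havg fold_right].
  - apply hscal_0.
  - rewrite <- IH, hscal_addr, !hscal_assoc.
    assert (INR (S (length l)) <> 0) by (apply not_0_INR; lia).
    f_equal; [rewrite Rinv_r by assumption; apply hscal_1|f_equal].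
    rewrite S_INR in *; field; assumption.
Qed.

(** The length times the average is the sum, which ignores the order, and a nonzero length can be
    divided out. *)
Lemma havg_perm (H : HilbertSpace) (l m : list H) : Permutation l m -> havg H l = havg H m.
Proof.
  intros Hlm.
  assert (Hs : fold_right (hadd H) (hzero H) l = fold_right (hadd H) (hzero H) m).
  { induction Hlm; simpl; [reflexivity| | |congruence].
    - rewrite IHHlm; reflexivity.
    - rewrite !hadd_assoc, (hadd_comm H y x); reflexivity. }
  rewrite <- !havg_sum, (Permutation_length Hlm) in Hs.
  destruct m as [|x m].
  - apply Permutation_sym, Permutation_nil in Hlm; subst; reflexivity.
  - assert (INR (length (x :: m)) <> 0) by (apply not_0_INR; simpl; lia).
    apply (f_equal (hscal H (/ INR (length (x :: m))))) in Hs.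
    rewrite !hscal_assoc, Rinv_l, !hscal_1 in Hs; assumption.
Qed.

Lemma havg_affine (G : Group) (H : HilbertSpace) (alpha : G -> H -> H) h (l : list H) :
  affine_isometric_action G H alpha -> l <> [] ->
  alpha h (havg H l) = havg H (map (alpha h) l).
Proof.
  intros (_ & _ & _ & Ha); induction l as [|x l IH]; intros Hl; [contradiction|].
  cbn [havg map]; rewrite Ha, length_map; f_equal.
  destruct l as [|y l].
  (* For a single vector the tail has weight [1 - 1 / 1 = 0], so the default value of [havg] on the
     empty list, which the action may move, drops out. *)
  - simpl; rewrite Rinv_1, Rminus_diag, !hscal_0; reflexivity.
  - rewrite IH by discriminate; reflexivity.
Qed.

(** [psi] is the squared displacement of a point fixed by the finite subgroup [L0 = 0], namely the
    average of the orbit of zero under it. Vanishing there is what later lets a multiple of [psi]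
    lie below [L0^2] on a ball. *)
Lemma haagerup_cnd (G : Group) (L0 : G -> R) :
  length_function G L0 -> proper_length G L0 -> haagerup G ->
  exists psi : G -> R, cnd psi /\ (forall r, finite_pred (fun g => psi g <= r)) /\
    forall g, L0 g = 0 -> psi g = 0.
Proof.
  intros (L0pos & L0one & L0mul & L0inv) L0p (H & alpha & Ha & Hp).
  destruct (finite_pred_exact _ (L0p 0)) as (K & HKn & HK).
  assert (HK1 : In gone K) by (apply HK; lra).
  set (x := havg H (map (fun k => alpha k (hzero H)) K)).
  assert (Hfix : forall h, L0 h = 0 -> alpha h x = x).
  { intros h Hh; unfold x.
    rewrite (havg_affine G H alpha h _ Ha)
      by (destruct K; [contradiction|discriminate]).
    rewrite map_map.
    replace (map (fun k => alpha h (alpha k (hzero H))) K) with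
      (map (fun k => alpha k (hzero H)) (map (gmul h) K))
      by (rewrite map_map; apply map_ext; intros; apply (proj1 (proj2 Ha))).
    (* Left translation by [h] permutes the subgroup [K]. *)
    apply havg_perm, Permutation_map, NoDup_Permutation; [|exact HKn|].
    - apply FinFun.Injective_map_NoDup; [|exact HKn].
      intros a b Hab; rewrite <- (gmul_1l G a), <- (gmul_1l G b), <- (gmul_Vl G h).
      rewrite <- !gmul_assoc, Hab; reflexivity.
    - intros k; rewrite in_map_iff, HK; split.
      + intros (k' & <- & Hk'); apply HK in Hk'; pose proof (L0mul h k'); lra.
      + intros Hk; exists (gmul (ginv h) k); split.
        * rewrite gmul_assoc, gmul_Vr, gmul_1l; reflexivity.
        * apply HK; pose proof (L0mul (ginv h) k); rewrite L0inv in *; lra. }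
  destruct Ha as (Ha1 & Ham & Hai & _).
  assert (HL : hilbert_length G (fun g => hdist H (alpha g x) x)).
  { exists H, (fun g => alpha g x); split.
    - intros g g' h; rewrite !Ham; apply Hai.
    - intros g; rewrite Ha1; reflexivity. }
  exists (fun g => hdist H (alpha g x) x ^ 2); split; [|split].
  - apply (hilbert_length_cnd _ HL).
  (* The ball is met at its centre [x]; its radius exceeds every [d >= 0] with [d^2 <= r]. *)
  - intros r; destruct (Hp x (Rabs r + 1)) as [l Hl]; exists l; intros g Hg; apply Hl.
    pose proof (Rabs_pos r); pose proof (Rle_abs r).
    exists x; rewrite hdist_refl; split; [lra|nra].
  - intros g Hg; rewrite Hfix, hdist_refl by exact Hg; ring.
Qed.

(** ** Schoenberg's theorem *)

Lemma psd_plus {X} (k1 k2 : X -> X -> R) : psd k1 -> psd k2 ->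
  psd (fun x y => k1 x y + k2 x y).
Proof.
  intros [S1 P1] [S2 P2]; split.
  - intros x y; rewrite S1, S2; reflexivity.
  - intros u; rewrite bform_plus; specialize (P1 u); specialize (P2 u); lra.
Qed.

Lemma psd_scal {X} a (k : X -> X -> R) : 0 <= a -> psd k -> psd (fun x y => a * k x y).
Proof.
  intros Ha [S P]; split.
  - intros x y; rewrite S; reflexivity.
  - intros u; rewrite bform_scal; apply Rmult_le_pos; auto.
Qed.

Lemma psd_rank1 {X} (f : X -> R) : psd (fun x y => f x * f y).
Proof.
  split; [intros; apply Rmult_comm|].
  intros u; rewrite ev_prod; apply Rle_0_sqr.
Qed.

Lemma psd_weight {X} (f : X -> R) (k : X -> X -> R) : psd k ->
  psd (fun x y => f x * f y * k x y).
Proof.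
  intros [S P]; split.
  - intros x y; rewrite S; ring.
  - intros u.
    assert (He : forall g, ev g (map (fun p => (fst p * f (snd p), snd p)) u) =
                   ev (fun x => f x * g x) u).
    { intros g; unfold ev; rewrite sum_list_map; apply sum_list_ext; intros; simpl; ring. }
    replace (bform (fun x y => f x * f y * k x y) u u) with
      (bform k (map (fun p => (fst p * f (snd p), snd p)) u)
               (map (fun p => (fst p * f (snd p), snd p)) u)); [apply P|].
    unfold bform; rewrite He; apply ev_ext; intros x.
    rewrite He, <- ev_scal; apply ev_ext; intros y; ring.
Qed.

(** The form of this kernel at [u] is that of [k] at [recenter p u]. *)
Lemma psd_recenter {X} (p : X) (k : X -> X -> R) : psd k ->
  psd (fun x y => k x y - k x p - (k p y - k p p)).
Proof.
  intros [S P]; split.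
  - intros x y; rewrite (S x y), (S x p), (S p y); ring.
  - intros u.
    replace (bform _ u u) with (bform k (recenter p u) (recenter p u)); [apply P|].
    unfold bform; rewrite ev_recenter; apply ev_ext; intros x.
    rewrite !ev_recenter; unfold Rminus at 1.
    replace (- ev (fun y => k p y - k p p) u) with
      (ev (fun y => -1 * (k p y - k p p)) u) by (rewrite ev_scal; ring).
    rewrite <- ev_plus; apply ev_ext; intros y; ring.
Qed.

Lemma psd_limit {X} (k : nat -> X -> X -> R) (l : X -> X -> R) :
  (forall n, psd (k n)) -> (forall x y, Un_cv (fun n => k n x y) (l x y)) -> psd l.
Proof.
  intros Hk Hl; split.
  - intros x y; apply (UL_sequence (fun n => k n x y)); [apply Hl|].
    replace (fun n => k n x y) with (fun n => k n y x); [apply Hl|].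
    apply functional_extensionality; intros n; apply (proj1 (Hk n)).
  - intros u; apply (Un_cv_ge (fun n => bform (k n) u u) _ _ 0).
    + intros n _; apply Hk.
    + apply sum_list_cv; intros p _.
      apply (CV_mult (fun _ => fst p)); [apply Un_cv_const|].
      apply sum_list_cv; intros q _.
      apply (CV_mult (fun _ => fst q)); [apply Un_cv_const|apply Hl].
Qed.

(** One step of Gaussian elimination: [a] is the row of [p] divided by [sqrt (k p p)], and
    Cauchy-Schwarz against [delta_p] keeps the remainder positive. If [k p p = 0] the row already
    vanishes. *)
Lemma psd_schur_complement {X} (k : X -> X -> R) (p : X) : psd k ->
  exists (k' : X -> X -> R) (a : X -> R), psd k' /\ (forall y, k' p y = 0) /\
    forall x y, k x y = k' x y + a x * a y.
Proof.
  intros Hk; pose proof (bform_semi_inner k Hk) as HB; destruct Hk as [S P].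
  assert (Hc : forall y, k p y * k p y <= k p p * k y y).
  { intros y; pose proof (si_cauchy_schwarz HB [(1, p)] [(1, y)]) as HC.
    unfold bform in HC; rewrite !ev_single in HC; exact HC. }
  assert (Hp0 : 0 <= k p p).
  { specialize (P [(1, p)]); unfold bform in P; rewrite !ev_single in P; exact P. }
  destruct (Req_dec (k p p) 0) as [H0|H0].
  - exists k, (fun _ => 0); split; [split; assumption|split].
    + intros y; specialize (Hc y); rewrite H0 in Hc.
      apply Rsqr_0_uniq, Rle_antisym; [unfold Rsqr; lra|apply Rle_0_sqr].
    + intros; ring.
  - assert (Hs : sqrt (k p p) * sqrt (k p p) = k p p) by (apply sqrt_sqrt; lra).
    assert (Hs0 : sqrt (k p p) <> 0) by (intros E; rewrite E in Hs; lra).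
    assert (Ha : forall x y, k x p / sqrt (k p p) * (k y p / sqrt (k p p)) =
                   k x p * k y p / k p p).
    { intros x y; rewrite <- Hs at 3; field; exact Hs0. }
    exists (fun x y => k x y - k x p / sqrt (k p p) * (k y p / sqrt (k p p))),
      (fun x => k x p / sqrt (k p p)).
    split; [split|split].
    + intros x y; rewrite S; ring.
    + intros u.
      replace (bform _ u u) with (bform k u u - ev (k p) u * ev (k p) u / k p p).
      * pose proof (si_cauchy_schwarz HB [(1, p)] u) as HC.
        rewrite <- !ev_as_bform, ev_single in HC.
        assert (ev (k p) u * ev (k p) u / k p p <= bform k u u); [|lra].
        apply Rmult_le_reg_r with (k p p); [lra|].
        unfold Rdiv; rewrite Rmult_assoc, Rinv_l by exact H0; lra.
      * transitivity (bform k u u + bform (fun x y => -1 / k p p * (k p x * k p y)) u u).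
        -- rewrite bform_scal, ev_prod; field; exact H0.
        -- rewrite <- bform_plus; apply bform_ext; intros x y.
           rewrite Ha, (S p x), (S p y); field; exact H0.
    + intros y; rewrite Ha, (S y p); field; exact H0.
    + intros; ring.
Qed.

Lemma psd_mult {X} (k1 k2 : X -> X -> R) : psd k1 -> psd k2 ->
  psd (fun x y => k1 x y * k2 x y).
Proof.
  intros H1 H2; split.
  - intros x y; rewrite (proj1 H1), (proj1 H2); reflexivity.
  - intros u; revert k1 H1.
    induction u as [|[c p] u IH]; intros k1 H1; [unfold bform, ev; simpl; lra|].
    destruct (psd_schur_complement k1 p H1) as (k' & a & Hk' & Hp & Hd).
    assert (Hp' : forall x, k' x p = 0) by (intros x; rewrite (proj1 Hk'); apply Hp).
    transitivity (bform (fun x y => k' x y * k2 x y) ((c, p) :: u) ((c, p) :: u) +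
      bform (fun x y => a x * a y * k2 x y) ((c, p) :: u) ((c, p) :: u)).
    2: { right; rewrite <- bform_plus; apply bform_ext; intros x y; rewrite Hd; ring. }
    apply Rplus_le_le_0_compat; [|apply psd_weight; exact H2].
    replace (bform _ ((c, p) :: u) ((c, p) :: u)) with (bform (fun x y => k' x y * k2 x y) u u);
      [apply IH; exact Hk'|].
    assert (Hc : forall f v, f p = 0 -> ev f ((c, p) :: v) = ev f v)
      by (intros f v Hf; unfold ev; simpl; rewrite Hf; ring).
    unfold bform; rewrite Hc.
    + apply ev_ext; intros x; rewrite Hc; [reflexivity|rewrite Hp'; ring].
    + transitivity (ev (fun _ : X => 0) ((c, p) :: u)).
      * apply ev_ext; intros y; rewrite Hp; ring.
      * rewrite ev_const; ring.
Qed.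

Lemma psd_pow {X} (k : X -> X -> R) n : psd k -> psd (fun x y => k x y ^ n).
Proof.
  intros Hk; induction n as [|n IH]; simpl.
  - replace (fun _ _ : X => 1) with (fun _ _ : X => 1 * 1); [apply (psd_rank1 (fun _ => 1))|].
    apply functional_extensionality; intros; apply functional_extensionality; intros; ring.
  - apply psd_mult; assumption.
Qed.

(** The partial sums of the exponential series are positive by the Schur product theorem, and
    positivity passes to the limit. *)
Lemma psd_exp {X} (k : X -> X -> R) : psd k -> psd (fun x y => exp (k x y)).
Proof.
  intros Hk.
  apply (psd_limit (fun n x y => sum_f_R0 (fun i => / INR (fact i) * k x y ^ i) n)).
  - assert (Hi : forall i, psd (fun x y => / INR (fact i) * k x y ^ i)).
    { intros i; apply psd_scal; [left; apply Rinv_0_lt_compat, INR_fact_lt_0|].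
      apply psd_pow, Hk. }
    intros n; induction n as [|n IH]; cbn [sum_f_R0]; [apply Hi|].
    apply psd_plus; [exact IH|apply Hi].
  - intros x y; exact (proj2_sig (exist_exp (k x y))).
Qed.

Lemma cnd_plus {G : Group} (psi1 psi2 : G -> R) : cnd psi1 -> cnd psi2 ->
  cnd (fun g => psi1 g + psi2 g).
Proof.
  intros (A1 & A2 & A3) (B1 & B2 & B3); split; [rewrite A1, B1; ring|split].
  - intros g; rewrite A2, B2; reflexivity.
  - replace (gker (fun g => psi1 g + psi2 g)) with
      (fun x y => gker psi1 x y + gker psi2 x y); [apply psd_plus; assumption|].
    apply functional_extensionality; intros x; apply functional_extensionality; intros y.
    unfold gker; field.
Qed.

Lemma cnd_scal {G : Group} a (psi : G -> R) : 0 <= a -> cnd psi -> cnd (fun g => a * psi g).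
Proof.
  intros Ha (A1 & A2 & A3); split; [rewrite A1; ring|split].
  - intros g; rewrite A2; reflexivity.
  - replace (gker (fun g => a * psi g)) with
      (fun x y => a * gker psi x y); [apply psd_scal; assumption|].
    apply functional_extensionality; intros x; apply functional_extensionality; intros y.
    unfold gker; field.
Qed.

(** [exp (- t psi (x^-1 y))] is [exp (2 t gker psi x y)] weighted by
    [exp (- t psi x) exp (- t psi y)], hence positive. Recentering it at [gone] gives twice the
    kernel of [1 - exp (- t psi)]. *)
Lemma cnd_one_minus_exp {G : Group} t (psi : G -> R) : 0 <= t -> cnd psi ->
  cnd (fun g => 1 - exp (- t * psi g)).
Proof.
  intros Ht (A1 & A2 & A3).
  set (M := fun x y => exp (- t * psi (gmul (ginv x) y))).
  assert (HM : psd M).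
  { replace M with (fun x y => exp (- t * psi x) * exp (- t * psi y) *
                      exp (2 * t * gker psi x y)).
    - apply psd_weight, psd_exp, psd_scal; [lra|exact A3].
    - apply functional_extensionality; intros x; apply functional_extensionality; intros y.
      unfold M; rewrite <- !exp_plus; f_equal; unfold gker; field. }
  split; [rewrite A1, Rmult_0_r, exp_0; ring|split].
  - intros g; rewrite A2; reflexivity.
  - replace (gker (fun g => 1 - exp (- t * psi g))) with
      (fun x y => / 2 * (M x y - M x gone - (M gone y - M gone gone))).
    + apply psd_scal; [lra|apply psd_recenter; exact HM].
    + apply functional_extensionality; intros x; apply functional_extensionality; intros y.
      unfold M, gker; rewrite gmul_1r, ginv_one, !gmul_1l, A1, A2, Rmult_0_r, exp_0; field.
Qed.

(** ** Compactness for pointwise convergence *)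

Definition close_on {X : Type} (a : nat -> X -> R) (l : list (X * R)) (eps : R) (m : nat) : Prop :=
  forall p, In p l -> Rabs (a m (fst p) - snd p) < eps.

(** Equivalently, a single subsequence takes all points listed in [l] to their prescribed values. *)
Definition cluster_on {X : Type} (a : nat -> X -> R) (l : list (X * R)) : Prop :=
  forall eps N, 0 < eps -> exists m, (N <= m)%nat /\ close_on a l eps m.

(* The new value is the limsup of [a m x] along the indices clustering on [l]. *)
Lemma cluster_on_cons {X} (a : nat -> X -> R) (b : X -> R) l x :
  (forall m x, 0 <= a m x <= b x) -> cluster_on a l ->
  exists r, cluster_on a ((x, r) :: l).
Proof.
  intros Hab Hl.
  set (E := fun r => forall eps N, 0 < eps ->
              exists m, (N <= m)%nat /\ close_on a l eps m /\ r <= a m x).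
  assert (Eb : bound E).
  { exists (b x); intros r Hr; destruct (Hr 1 0%nat ltac:(lra)) as (m & _ & _ & Hm).
    specialize (Hab m x); lra. }
  assert (E0 : exists r, E r).
  { exists 0; intros eps N He; destruct (Hl eps N He) as (m & Hm & Hc).
    exists m; repeat split; try assumption; apply Hab. }
  destruct (completeness E Eb E0) as [r [Hub Hlub]].
  exists r; intros eps N He.
  assert (Hlow : exists s, E s /\ r - eps < s).
  { apply NNPP; intros Hn; assert (r <= r - eps); [|lra].
    apply Hlub; intros s Hs; apply Rnot_lt_le; intros Hlt; apply Hn; eauto. }
  destruct Hlow as (s & Hs & Hsr).
  assert (Hup : ~ E (r + eps / 2)) by (intros HE; specialize (Hub _ HE); lra).
  apply not_all_ex_not in Hup; destruct Hup as [eps0 Hup].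
  apply not_all_ex_not in Hup; destruct Hup as [N0 Hup].
  apply imply_to_and in Hup; destruct Hup as [He0 Hup].
  destruct (Hs (Rmin eps eps0) (max N N0)) as (m & Hm & Hc & Hsm);
    [apply Rmin_glb_lt; assumption|].
  exists m; split; [lia|].
  intros p [<-|Hp]; simpl.
  - assert (a m x < r + eps / 2).
    { apply Rnot_le_lt; intros Hle; apply Hup; exists m; split; [lia|split; [|exact Hle]].
      intros p Hp; eapply Rlt_le_trans; [apply Hc, Hp|apply Rmin_r]. }
    apply Rabs_def1; lra.
  - eapply Rlt_le_trans; [apply Hc, Hp|apply Rmin_l].
Qed.

(** The point of code [n] gets its value at stage [n], and the lists of prescribed values increase.
    The subsequence depends on the finite list [l], which suffices because later uses read finitely
    many points at a time. *)
Lemma pointwise_cluster_point {X : Type} (a : nat -> X -> R) (b : X -> R) :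
  countable X -> (forall m x, 0 <= a m x <= b x) ->
  exists lim : X -> R, forall l : list X, exists phi : nat -> nat,
    (forall n, (n <= phi n)%nat) /\
    forall x, In x l -> Un_cv (fun n => a (phi n) x) (lim x).
Proof.
  intros [f Hf] Hab.
  set (C := {l : list (X * R) | cluster_on a l}).
  destruct (choice (fun (p : nat * C) (l' : C) =>
    incl (proj1_sig (snd p)) (proj1_sig l') /\
    forall x, f x = fst p -> exists r, In (x, r) (proj1_sig l'))) as [step Hstep].
  { intros [n l]; simpl.
    destruct (classic (exists x, f x = n)) as [[x Hx]|Hn].
    - destruct (cluster_on_cons a b (proj1_sig l) x Hab (proj2_sig l)) as [r Hr].
      exists (exist _ _ Hr); simpl; split; [apply incl_tl, incl_refl|].
      intros y Hy; rewrite <- Hx in Hy; apply Hf in Hy; subst y; exists r; auto.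
    - exists l; split; [apply incl_refl|]; intros x Hx; exfalso; eauto. }
  assert (Hnil : cluster_on a []) by (intros eps N _; exists N; split; [lia|intros p []]).
  set (lst := fix lst n : C :=
    match n with O => exist _ [] Hnil | S n' => step (n', lst n') end).
  assert (Hmono : forall n m, (n <= m)%nat -> incl (proj1_sig (lst n)) (proj1_sig (lst m))).
  { intros n m; induction 1 as [|m _ IH]; [apply incl_refl|].
    eapply incl_tran; [exact IH|apply (proj1 (Hstep (m, lst m)))]. }
  (* Stage [f x] handles [x] and produces list number [S (f x)]. *)
  destruct (choice (fun x r => In (x, r) (proj1_sig (lst (S (f x)))))) as [lim Hlim].
  { intros x; apply (proj2 (Hstep (f x, lst (f x)))); reflexivity. }
  exists lim; intros l.
  assert (Hl : exists N, forall x, In x l -> In (x, lim x) (proj1_sig (lst N))).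
  { induction l as [|x l [N HN]]; [exists 0%nat; intros x []|].
    exists (max N (S (f x))); intros y [<-|Hy].
    - apply (Hmono (S (f x))); [lia|apply Hlim].
    - apply (Hmono N); [lia|auto]. }
  destruct Hl as [N HN].
  destruct (choice (fun n m => (n <= m)%nat /\
              close_on a (proj1_sig (lst N)) (/ (INR n + 1)) m)) as [phi Hphi].
  { intros n; apply (proj2_sig (lst N)), inv_INR_pos. }
  exists phi; split; [intros n; apply Hphi|].
  intros x Hx eps He; destruct (inv_INR_small eps He) as [M HM].
  exists M; intros n Hn; unfold Rdist.
  eapply Rlt_trans; [apply (proj2 (Hphi n) _ (HN x Hx))|apply HM; lia].
Qed.

Lemma gker_sym {G : Group} (psi : G -> R) x y :
  (forall g, psi (ginv g) = psi g) -> gker psi x y = gker psi y x.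
Proof.
  intros H; unfold gker; rewrite <- (H (gmul (ginv x) y)), ginv_mul, ginv_inv; f_equal; ring.
Qed.

Lemma cnd_cluster_point {G : Group} (psi : nat -> G -> R) (b : G -> R) :
  countable G -> (forall m, cnd (psi m)) -> (forall m g, psi m g <= b g) ->
  exists lim : G -> R, cnd lim /\ forall g, exists phi : nat -> nat,
    (forall n, (n <= phi n)%nat) /\ Un_cv (fun n => psi (phi n) g) (lim g).
Proof.
  intros HG Hc Hb.
  destruct (pointwise_cluster_point psi b HG) as [lim Hlim].
  { intros m g; split; [apply cnd_nonneg, Hc|apply Hb]. }
  assert (Hinv : forall g, lim (ginv g) = lim g).
  { intros g; destruct (Hlim [g; ginv g]) as (phi & _ & H).
    apply (UL_sequence (fun n => psi (phi n) g)); [|apply H; simpl; auto].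
    replace (fun n => psi (phi n) g) with (fun n => psi (phi n) (ginv g));
      [apply H; simpl; auto|].
    apply functional_extensionality; intros n; apply (Hc (phi n)). }
  exists lim; split; [split; [|split; [exact Hinv|split]]|].
  - destruct (Hlim [gone]) as (phi & _ & H).
    apply (UL_sequence (fun n => psi (phi n) gone)); [apply H; simpl; auto|].
    replace (fun n => psi (phi n) gone) with (fun _ : nat => 0); [apply Un_cv_const|].
    apply functional_extensionality; intros n; symmetry; apply (Hc (phi n)).
  - intros x y; apply gker_sym, Hinv.
  - intros u.
    (* The form at [u] reads [psi] only at the points [x] of [u] and at the quotients [x^-1 y]. *)
    destruct (Hlim (map snd u ++
                map (fun q => gmul (ginv (snd (fst q))) (snd (snd q))) (list_prod u u)))
      as (phi & _ & H).
    apply (Un_cv_ge (fun n => bform (gker (psi (phi n))) u u) _ _ 0).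
    { intros n _; apply (Hc (phi n)). }
    assert (Hu : forall p, In p u -> Un_cv (fun n => psi (phi n) (snd p)) (lim (snd p)))
      by (intros p Hp; apply H, in_or_app; left; apply in_map; exact Hp).
    apply sum_list_cv; intros p Hp.
    apply (CV_mult (fun _ => fst p)); [apply Un_cv_const|].
    apply sum_list_cv; intros q Hq.
    apply (CV_mult (fun _ => fst q)); [apply Un_cv_const|].
    apply (CV_mult _ (fun _ => / 2)); [|apply Un_cv_const].
    apply CV_minus; [apply CV_plus; apply Hu; assumption|].
    apply H, in_or_app; right.
    apply (in_map (fun q => gmul (ginv (snd (fst q))) (snd (snd q))) _ (p, q)).
    apply in_prod; assumption.
  - intros g; destruct (Hlim [g]) as (phi & H1 & H2).
    exists phi; split; [exact H1|apply H2; simpl; auto].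
Qed.

(** ** A minimax theorem *)

Lemma approximate_minimizer {A : Type} (P : A -> Prop) (Phi : A -> R) (eps : R) :
  (exists a, P a) -> (forall a, 0 <= Phi a) -> 0 < eps ->
  exists a, P a /\ forall b, P b -> Phi a <= Phi b + eps.
Proof.
  intros [a0 Ha0] Hpos He.
  (* The infimum of [Phi] is minus the supremum of [- Phi]. *)
  destruct (completeness (fun r => exists a, P a /\ r = - Phi a)) as [m [Hub Hlub]].
  - exists 0; intros r (a & _ & ->); specialize (Hpos a); lra.
  - exists (- Phi a0), a0; auto.
  - apply NNPP; intros Hn; assert (m <= m - eps); [|lra].
    apply Hlub; intros r (a & Ha & ->); apply Rnot_lt_le; intros Hlt; apply Hn.
    exists a; split; [exact Ha|]; intros b Hb.
    assert (- Phi b <= m) by (apply Hub; eauto); lra.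
Qed.

Lemma sum_list_In_le {T} (f : T -> R) (l : list T) x :
  (forall y, 0 <= f y) -> In x l -> f x <= sum_list f l.
Proof.
  intros Hf; induction l as [|y l IH]; simpl; intros Hx; [contradiction|].
  pose proof (sum_list_nonneg f l (fun y _ => Hf y)); pose proof (Hf y).
  destruct Hx as [->|Hx]; [lra|specialize (IH Hx); lra].
Qed.

(* The weights are [(kappa - f0)^+] for an approximate minimizer [f0] on the
   convex set of the squared distance to the orthant [f >= kappa]. *)
Lemma minimax_weights {T : Type} (S : list T) (C : (T -> R) -> Prop) (kappa M : R) :
  (exists f, C f) ->
  (forall f g t, C f -> C g -> 0 <= t <= 1 -> C (fun x => f x + t * (g x - f x))) ->
  (forall f g, C f -> C g -> sum_list (fun x => (g x - f x) ^ 2) S <= M) ->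
  (forall f, C f -> exists x, In x S /\ f x <= kappa - 1) ->
  exists f0, C f0 /\ 0 < sum_list (fun x => Rmax 0 (kappa - f0 x)) S /\
    forall f, C f -> sum_list (fun x => Rmax 0 (kappa - f0 x) * f x) S <=
                     kappa * sum_list (fun x => Rmax 0 (kappa - f0 x)) S.
Proof.
  intros Hne Hconv HM Hgap.
  assert (HM0 : 0 <= M).
  { destruct Hne as [f Hf]; eapply Rle_trans; [|apply (HM f f Hf Hf)].
    apply sum_list_nonneg; intros; apply pow2_ge_0. }
  (* [t] is both the tolerance of the minimizer and the length of the step towards [f]. As
     [t * M = 1 - t], minimality divided by [t] bounds twice the first variation [A] by
     [t * D + 1 <= 2]. *)
  set (t := / (M + 1)).
  assert (Ht : 0 < t) by (apply Rinv_0_lt_compat; lra).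
  assert (HtM : t * M = 1 - t) by (unfold t; field; lra).
  assert (Ht1 : t <= 1) by nra.
  destruct (approximate_minimizer C (fun f => sum_list (fun x => Rmax 0 (kappa - f x) ^ 2) S)
              t Hne) as (f0 & Hf0 & Hmin); [|exact Ht|].
  { intros f; apply sum_list_nonneg; intros; apply pow2_ge_0. }
  set (w := fun x => Rmax 0 (kappa - f0 x)).
  assert (Hw : forall x, 0 <= w x) by (intros x; apply Rmax_l).
  destruct (Hgap f0 Hf0) as (x0 & Hx0 & Hgx0).
  assert (Hw0 : 1 <= w x0).
  { eapply Rle_trans; [|apply Rmax_r]; lra. }
  exists f0; fold w; split; [exact Hf0|split].
  { change (0 < sum_list w S).
    eapply Rlt_le_trans; [|apply (sum_list_In_le w S x0); assumption]; lra. }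
  intros f Hf.
  (* The gap of 1 below [kappa] supplies this lower bound, which absorbs the error [A <= 1] at the
     end. *)
  assert (Hwsq : 1 <= sum_list (fun x => w x ^ 2) S).
  { eapply Rle_trans; [|apply (sum_list_In_le _ S x0); [intros; apply pow2_ge_0|assumption]].
    nra. }
  specialize (Hmin _ (Hconv f0 f t Hf0 Hf ltac:(lra))).
  assert (Hexp : sum_list (fun x => Rmax 0 (kappa - (f0 x + t * (f x - f0 x))) ^ 2) S <=
    sum_list (fun x => w x ^ 2) S + (-2 * t) * sum_list (fun x => w x * (f x - f0 x)) S +
    t * t * sum_list (fun x => (f x - f0 x) ^ 2) S).
  { rewrite <- !sum_list_scal, <- !sum_list_plus; apply sum_list_le; intros x _.
    (* Replacing [kappa - f0 x] by the larger [w x] only raises a positive part, so the square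
       bounds it. *)
    replace (w x ^ 2 + -2 * t * (w x * (f x - f0 x)) + t * t * (f x - f0 x) ^ 2)
      with ((w x - t * (f x - f0 x)) ^ 2) by ring.
    assert (kappa - f0 x <= w x) by apply Rmax_r.
    unfold Rmax at 1; destruct (Rle_dec _ _); [apply pow_incr; lra|].
    rewrite pow_i by lia; apply pow2_ge_0. }
  specialize (HM f0 f Hf0 Hf).
  set (A := sum_list (fun x => w x * (f x - f0 x)) S) in *.
  set (D := sum_list (fun x => (f x - f0 x) ^ 2) S) in *.
  assert (HA : A <= 1).
  { assert (t * D <= 1 - t) by (rewrite <- HtM; apply Rmult_le_compat_l; lra).
    pose proof (Rle_trans _ _ _ Hmin (Rplus_le_compat_r t _ _ Hexp)) as HA.
    change (sum_list (fun x => w x ^ 2) S <=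
      sum_list (fun x => w x ^ 2) S + -2 * t * A + t * t * D + t) in HA.
    apply Rmult_le_reg_l with t; [exact Ht|].
    assert (t * (t * D) <= t * (1 - t)) by (apply Rmult_le_compat_l; lra).
    nra. }
  change (sum_list (fun x => w x * f x) S <= kappa * sum_list w S).
  (* Pointwise [w * f0 = kappa * w - w^2], whether [w] is zero or not. *)
  replace (sum_list (fun x => w x * f x) S) with
    (A + (kappa * sum_list w S - sum_list (fun x => w x ^ 2) S)); [|].
  - lra.
  - replace (kappa * sum_list w S - sum_list (fun x => w x ^ 2) S) with
      (sum_list (fun x => w x * f0 x) S).
    + unfold A; rewrite <- sum_list_plus; apply sum_list_ext; intros; ring.
    + replace (kappa * sum_list w S - sum_list (fun x => w x ^ 2) S) with
        (kappa * sum_list w S + -1 * sum_list (fun x => w x ^ 2) S) by ring.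
      rewrite <- !sum_list_scal, <- sum_list_plus; apply sum_list_ext; intros x _.
      unfold w, Rmax; destruct (Rle_dec _ _); ring.
Qed.

(** ** Measures witnessing the failure of the Haagerup property *)

(** [expectation_le] ranges over all lists containing the support; this reduces them to one. *)
Lemma sum_list_support {T : Type} (h : T -> R) (S S' : list T) :
  NoDup S -> NoDup S' -> (forall x, h x <> 0 -> In x S) -> (forall x, h x <> 0 -> In x S') ->
  sum_list h S = sum_list h S'.
Proof.
  intros HS HS' Hh Hh'.
  set (p := fun x => if Req_dec_T (h x) 0 then false else true).
  assert (Hf : forall l, sum_list h l = sum_list h (filter p l)).
  { intros l; induction l as [|x l IH]; simpl; [reflexivity|].
    unfold p at 1; destruct (Req_dec_T (h x) 0) as [E|E]; simpl; rewrite IH; [rewrite E|]; ring. }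
  rewrite (Hf S), (Hf S'); apply sum_list_perm, NoDup_Permutation.
  - apply NoDup_filter, HS.
  - apply NoDup_filter, HS'.
  - intros x; rewrite !filter_In; unfold p.
    destruct (Req_dec_T (h x) 0) as [E|E]; split; intros [H1 H2]; auto; discriminate.
Qed.

(** The weights [2^-(n+1)] have total at most 1, so a common upper bound [L0^2] is preserved. *)
Fixpoint wsum {T : Type} (f : nat -> T -> R) (N : nat) (x : T) : R :=
  match N with
  | O => 0
  | S n => wsum f n x + (/ 2) ^ (S n) * f n x
  end.

Lemma wsum_le {T : Type} (f : nat -> T -> R) b N x :
  (forall n, f n x <= b) -> wsum f N x <= (1 - (/ 2) ^ N) * b.
Proof.
  intros Hb; induction N as [|N IH]; simpl; [lra|].
  assert (0 < (/ 2) ^ N) by (apply pow_lt; lra).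
  specialize (Hb N); nra.
Qed.

Lemma wsum_term_le {T : Type} (f : nat -> T -> R) N j x :
  (forall n, 0 <= f n x) -> (j < N)%nat -> (/ 2) ^ (S j) * f j x <= wsum f N x.
Proof.
  intros Hf Hj.
  assert (Ht : forall n, 0 <= (/ 2) ^ (S n) * f n x)
    by (intros n; apply Rmult_le_pos; [apply pow_le; lra|apply Hf]).
  assert (Hw : forall n, 0 <= wsum f n x)
    by (intros n; induction n as [|n IH]; cbn [wsum]; [lra|specialize (Ht n); lra]).
  induction Hj as [|N Hj IH]; cbn [wsum].
  - specialize (Hw j); lra.
  - specialize (Ht N); lra.
Qed.

Lemma cnd_zero {G : Group} : cnd (fun _ : G => 0).
Proof.
  split; [reflexivity|split; [reflexivity|]].
  replace (gker (fun _ : G => 0)) with (fun _ _ : G => 0 * 0);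
    [apply (psd_rank1 (fun _ : G => 0))|].
  apply functional_extensionality; intros x; apply functional_extensionality; intros y.
  unfold gker; field.
Qed.

Lemma cnd_wsum {G : Group} (psi : nat -> G -> R) N :
  (forall n, cnd (psi n)) -> cnd (wsum psi N).
Proof.
  intros Hp; induction N as [|N IH]; [exact cnd_zero|].
  apply cnd_plus; [exact IH|].
  apply cnd_scal; [apply pow_le; lra|apply Hp].
Qed.

Lemma small_off_finite (G : Group) (L0 : G -> R) (HG : countable G)
    (HL0p : proper_length G L0) : ~ haagerup G ->
  exists kappa, forall n (psi : G -> R), cnd psi -> (forall g, psi g <= L0 g ^ 2) ->
    exists g, INR n <= L0 g /\ psi g < kappa.
Proof.
  intros Hnh; apply NNPP; intros Hn; apply Hnh.
  (* Negating the claim at [kappa = 2^(j+1) j] yields a function at least that large beyond the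
     radius [fst (q j)]; with weight [2^-(j+1)] it contributes at least [j] there. *)
  destruct (choice (fun j (q : nat * (G -> R)) =>
    cnd (snd q) /\ (forall g, snd q g <= L0 g ^ 2) /\
    forall g, INR (fst q) <= L0 g -> 2 ^ S j * INR j <= snd q g)) as [q Hq].
  { intros j; apply NNPP; intros Hj; apply Hn; exists (2 ^ S j * INR j).
    intros n psi Hc Hb; apply NNPP; intros Hg; apply Hj; exists (n, psi); simpl fst; simpl snd.
    split; [exact Hc|split; [exact Hb|]].
    intros g Hng; apply Rnot_lt_le; intros Hlt; apply Hg; eauto. }
  set (psi := fun j => snd (q j)).
  assert (Hpsi : forall j, cnd (psi j)) by (intros j; apply Hq).
  (* A cluster point of the partial sums stands for the sum of the series. *)
  destruct (cnd_cluster_point (fun N => wsum psi N) (fun g => L0 g ^ 2) HG) as (lim & Hc & Hlim).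
  { intros m; apply cnd_wsum, Hpsi. }
  { intros m g; eapply Rle_trans; [apply (wsum_le psi (L0 g ^ 2)); intros n; apply Hq|].
    assert (0 < (/ 2) ^ m) by (apply pow_lt; lra).
    pose proof (pow2_ge_0 (L0 g)); nra. }
  apply (cnd_proper_haagerup lim Hc).
  intros r; destruct (INR_unbounded r) as [j Hj].
  destruct (HL0p (INR (fst (q j)))) as [l Hl]; exists l; intros g Hg; apply Hl.
  apply Rnot_lt_le; intros Hlt.
  destruct (Hlim g) as (phi & Hphi & Hcv).
  assert (INR j <= lim g); [|lra].
  refine (Un_cv_ge _ _ _ (S j) _ Hcv).
  intros n Hn'; specialize (Hphi n).
  eapply Rle_trans;
    [|apply (wsum_term_le psi _ j); [intros i; apply cnd_nonneg, Hpsi|lia]].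
  destruct (Hq j) as (_ & _ & Hbig); specialize (Hbig g ltac:(lra)).
  assert (Hp : 0 < (/ 2) ^ S j) by (apply pow_lt; lra).
  apply Rle_trans with ((/ 2) ^ S j * (2 ^ S j * INR j)).
  - rewrite <- Rmult_assoc, <- Rpow_mult_distr, Rinv_l, pow1 by lra; lra.
  - apply Rmult_le_compat_l; [lra|exact Hbig].
Qed.

(** If every [m] had a counterexample, a cluster point of these would be at least [kappa] wherever
    [L0 >= n], because each [g] with [L0 g >= n] lies in all sufficiently large shells. This
    contradicts [small_off_finite]. *)
Lemma small_on_shell (G : Group) (L0 : G -> R) (HG : countable G)
    (HL0p : proper_length G L0) : ~ haagerup G ->
  exists kappa, forall n, exists m, forall psi : G -> R, cnd psi ->
    (forall g, psi g <= L0 g ^ 2) ->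
    exists g, (INR n <= L0 g <= INR m) /\ psi g <= kappa.
Proof.
  intros Hnh; destruct (small_off_finite G L0 HG HL0p Hnh) as [kappa Hk].
  exists kappa; intros n; apply NNPP; intros Hn.
  destruct (choice (fun m psi => cnd psi /\ (forall g, psi g <= L0 g ^ 2) /\
    forall g, INR n <= L0 g <= INR m -> kappa <= psi g)) as [psi Hpsi].
  { intros m; apply NNPP; intros Hm; apply Hn; exists m.
    intros psi Hc Hb; apply NNPP; intros Hg; apply Hm; exists psi.
    split; [exact Hc|split; [exact Hb|]].
    intros g Hng; apply Rnot_lt_le; intros Hlt; apply Hg; exists g; split; [exact Hng|lra]. }
  destruct (cnd_cluster_point psi (fun g => L0 g ^ 2) HG) as (lim & Hc & Hlim);
    [apply Hpsi|apply Hpsi|].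
  destruct (Hk n lim Hc) as (g & Hng & Hg).
  { intros g; destruct (Hlim g) as (phi & _ & Hcv).
    refine (Un_cv_le _ _ _ 0 _ Hcv); intros m _; apply Hpsi. }
  destruct (Hlim g) as (phi & Hphi & Hcv).
  destruct (INR_unbounded (L0 g)) as [N HN].
  assert (kappa <= lim g); [|lra].
  refine (Un_cv_ge _ _ _ N _ Hcv).
  intros k Hkn; apply Hpsi; split; [exact Hng|].
  specialize (Hphi k); assert (INR N <= INR (phi k)) by (apply le_INR; lia); lra.
Qed.

(* The measure is supported on a shell [n <= L0 <= m], which is symmetric, and
   its weights come from a function of negative type, so it is symmetric too. *)
Lemma shell_measure (G : Group) (L0 : G -> R) (n m : nat) (kappa : R) :
  length_function G L0 -> proper_length G L0 ->
  (forall psi : G -> R, cnd psi -> (forall g, psi g <= L0 g ^ 2) ->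
     exists g, (INR n <= L0 g <= INR m) /\ psi g <= kappa - 1) ->
  exists mu : G -> R, symmetric_measure G mu /\ prob_supported_far G L0 n mu /\
    forall psi : G -> R, cnd psi -> (forall g, psi g <= L0 g ^ 2) ->
      expectation_le mu psi kappa.
Proof.
  intros (_ & _ & _ & L0inv) L0p Hgap.
  destruct (finite_pred_exact (fun g => INR n <= L0 g <= INR m)) as (S & HSn & HS).
  { destruct (L0p (INR m)) as [l Hl]; exists l; intros g [_ Hg]; auto. }
  destruct (minimax_weights S (fun psi => cnd psi /\ forall g, psi g <= L0 g ^ 2) kappa
              (sum_list (fun g => (L0 g ^ 2) ^ 2) S)) as (f0 & [Hf0 Hf0b] & HW & Hw).
  - exists (fun _ => 0); split; [apply cnd_zero|intros g; apply pow2_ge_0].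
  - intros f g t [Hf Hfb] [Hg Hgb] Ht; split.
    + replace (fun x => f x + t * (g x - f x)) with (fun x => (1 - t) * f x + t * g x)
        by (apply functional_extensionality; intros; ring).
      apply cnd_plus; apply cnd_scal; try assumption; lra.
    + intros x; specialize (Hfb x); specialize (Hgb x); nra.
  - intros f g [Hf Hfb] [Hg Hgb]; apply sum_list_le; intros x _.
    specialize (Hfb x); specialize (Hgb x).
    pose proof (cnd_nonneg f x Hf); pose proof (cnd_nonneg g x Hg).
    apply pow_maj_Rabs, Rabs_le; lra.
  - intros f [Hf Hfb]; destruct (Hgap f Hf Hfb) as (g & Hg & Hgk).
    exists g; split; [apply HS; exact Hg|exact Hgk].
  - set (w := fun x => Rmax 0 (kappa - f0 x)) in *.
    set (W := sum_list w S) in *.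
    set (mu := fun g => if excluded_middle_informative (INR n <= L0 g <= INR m)
                        then w g / W else 0).
    assert (HmuS : forall x, mu x <> 0 -> In x S).
    { intros x Hx; apply HS; unfold mu in Hx.
      destruct (excluded_middle_informative _); [assumption|contradiction]. }
    assert (Hsum : forall f, sum_list (fun x => f x * mu x) S =
                     sum_list (fun x => w x * f x) S / W).
    { intros f; unfold Rdiv; rewrite Rmult_comm, <- sum_list_scal.
      apply sum_list_ext; intros x Hx; apply HS in Hx; unfold mu.
      destruct (excluded_middle_informative _); [|contradiction].
      unfold Rdiv; ring. }
    exists mu; split; [|split; [split|]].
    + intros g; unfold mu, w; rewrite L0inv, (proj1 (proj2 Hf0)); reflexivity.
    + intros g; unfold mu; destruct (excluded_middle_informative _); [|lra].
      apply Rmult_le_pos; [apply Rmax_l|left; apply Rinv_0_lt_compat; exact HW].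
    + exists S; split; [split; assumption|split; [intros g Hg; apply HS; exact Hg|]].
      transitivity (sum_list (fun x => 1 * mu x) S).
      * apply sum_list_ext; intros; ring.
      * rewrite (Hsum (fun _ => 1)).
        replace (sum_list (fun x => w x * 1) S) with W
          by (apply sum_list_ext; intros; ring).
        field; lra.
    + intros psi Hc Hb S' [HS'n HS'].
      rewrite (sum_list_support (fun x => psi x * mu x) S' S HS'n HSn).
      * rewrite Hsum; apply Rmult_le_reg_r with W; [exact HW|].
        unfold Rdiv; rewrite Rmult_assoc, Rinv_l, Rmult_1_r by lra.
        apply Hw; split; assumption.
      * intros x Hx; apply HS'; intros E; apply Hx; rewrite E; ring.
      * intros x Hx; apply HmuS; intros E; apply Hx; rewrite E; ring.
Qed.

Lemma not_haagerup_relative_FH (G : Group) (L0 : G -> R) (HG : countable G)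
    (HL0 : length_function G L0) (HL0p : proper_length G L0) :
  ~ haagerup G ->
  exists mu : nat -> G -> R,
    (forall n : nat, symmetric_measure G (mu n) /\ prob_supported_far G L0 n (mu n)) /\
    relative_FH G L0 mu.
Proof.
  intros Hnh; destruct (small_on_shell G L0 HG HL0p Hnh) as [kappa Hk].
  pose proof (Rabs_pos kappa); pose proof (Rle_abs kappa).
  (* [|kappa| + 1] is positive, independent of [n], and leaves the gap of 1 that the minimax
     argument consumes. *)
  destruct (choice (fun n mu => symmetric_measure G mu /\ prob_supported_far G L0 n mu /\
    forall psi : G -> R, cnd psi -> (forall g, psi g <= L0 g ^ 2) ->
      expectation_le mu psi (Rabs kappa + 1))) as [mu Hmu].
  { intros n; destruct (Hk n) as [m Hm]; apply (shell_measure G L0 n m); try assumption.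
    intros psi Hc Hb; destruct (Hm psi Hc Hb) as (g & Hg & Hgk).
    exists g; split; [exact Hg|lra]. }
  exists mu; split; [intros n; split; apply Hmu|].
  exists (Rabs kappa + 1); split; [lra|].
  intros L HL HLb n; apply (proj2 (proj2 (Hmu n))).
  - apply hilbert_length_cnd, HL.
  - destruct HL as (E & F & _ & HF); intros g; apply pow_incr; split; [|apply HLb].
    rewrite HF; apply hdist_nonneg.
Qed.

(** ** Large Hilbert lengths on Haagerup groups *)

Lemma common_small_scale {T : Type} (a b : T -> R) (l : list T) :
  (forall x, 0 <= b x) -> (forall x, b x = 0 -> a x = 0) ->
  exists t, 0 < t /\ forall x, In x l -> t * a x <= b x.
Proof.
  intros Hb Hab; induction l as [|x l [t [Ht IH]]]; [exists 1; split; [lra|intros x []]|].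
  (* Asked for all smaller scales, so that it survives the minimum with [t]. *)
  assert (Hx : exists s, 0 < s /\ forall s', 0 < s' <= s -> s' * a x <= b x).
  { destruct (Hb x) as [Hx|Hx].
    - pose proof (Rabs_pos (a x)); pose proof (Rle_abs (a x)).
      exists (b x / (Rabs (a x) + 1)); split; [apply Rdiv_lt_0_compat; lra|].
      intros s' Hs'.
      assert (s' * (Rabs (a x) + 1) <= b x).
      { apply Rle_trans with (b x / (Rabs (a x) + 1) * (Rabs (a x) + 1)).
        - apply Rmult_le_compat_r; lra.
        - right; field; lra. }
      nra.
    - exists 1; split; [lra|]; intros s' _; rewrite (Hab x); lra. }
  destruct Hx as (s & Hs & Hx).
  assert (Hm : 0 < Rmin t s) by (apply Rmin_glb_lt; assumption).
  exists (Rmin t s); split; [exact Hm|]; intros y [<-|Hy].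
  - apply Hx; split; [exact Hm|apply Rmin_r].
  - specialize (IH y Hy); pose proof (Rmin_l t s); specialize (Hb y).
    destruct (Rle_dec (a y) 0); nra.
Qed.

(** [theta = 2 M (1 - exp (- t psi))] is at most [2 M t psi] and at most [2 M]. For small [t] the
    first bound gives [theta <= L0^2] on the finite ball [L0 <= 2 M + 1]; the second gives it
    elsewhere. Once [psi > 1 / t], the exponential is at most [1 / 2] and [theta >= M]. *)
Lemma haagerup_large_length (G : Group) (L0 : G -> R) (M : R) :
  length_function G L0 -> proper_length G L0 -> haagerup G -> 0 < M ->
  exists (L : G -> R) (r : R), hilbert_length G L /\ (forall g, L g <= L0 g) /\
    forall g, r < L0 g -> M <= L g ^ 2.
Proof.
  intros HL0 HL0p Hh HM.
  destruct (haagerup_cnd G L0 HL0 HL0p Hh) as (psi & Hc & Hp & H0).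
  destruct HL0 as (L0pos & _).
  destruct (HL0p (2 * M + 1)) as [l Hl].
  destruct (common_small_scale (fun g => 2 * M * psi g) (fun g => L0 g ^ 2) l) as (t & Ht & Htl).
  { intros g; apply pow2_ge_0. }
  { intros g Hg; rewrite H0; [ring|].
    apply Rsqr_0_uniq; unfold Rsqr; rewrite <- Hg; ring. }
  set (theta := fun g => 2 * M * (1 - exp (- t * psi g))).
  assert (Hth : cnd theta).
  { apply cnd_scal; [lra|]; apply cnd_one_minus_exp; [lra|exact Hc]. }
  destruct (Hp (1 / t)) as [l2 Hl2].
  assert (Hr : exists r, forall g, In g l2 -> L0 g <= r).
  { clear Hl2; induction l2 as [|x l2 [r IH]]; [exists 0; intros g []|].
    exists (Rmax (L0 x) r); intros g [<-|Hg]; [apply Rmax_l|].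
    eapply Rle_trans; [apply IH, Hg|apply Rmax_r]. }
  destruct Hr as [r Hr].
  exists (fun g => sqrt (theta g)), r; split; [apply cnd_hilbert_length, Hth|split].
  - intros g; apply sqrt_le_of_sq; [apply L0pos|]; unfold theta.
    destruct (Rle_dec (L0 g) (2 * M + 1)) as [Hg|Hg].
    + specialize (Htl g (Hl g Hg)).
      pose proof (exp_ineq1_le (- t * psi g)); nra.
    + pose proof (exp_pos (- t * psi g)); nra.
  - intros g Hg; rewrite pow2_sqrt by (apply cnd_nonneg, Hth).
    assert (1 / t < psi g).
    { apply Rnot_le_lt; intros Hle; specialize (Hr g (Hl2 g Hle)); lra. }
    assert (1 < t * psi g).
    { apply Rmult_lt_reg_l with (/ t); [apply Rinv_0_lt_compat, Ht|].
      rewrite <- Rmult_assoc, Rinv_l by lra; lra. }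
    assert (He : exp (- t * psi g) * exp (t * psi g) = 1)
      by (rewrite <- exp_plus, <- exp_0; f_equal; ring).
    pose proof (exp_ineq1_le (t * psi g)); pose proof (exp_pos (- t * psi g)).
    assert (exp (- t * psi g) <= / 2) by nra.
    unfold theta; nra.
Qed.

(** For [n > r] the support of [mu n] lies where [L^2 >= K + 1], so the expectation of [L^2] exceeds
    [K]. *)
Lemma relative_FH_not_haagerup (G : Group) (L0 : G -> R)
    (HL0 : length_function G L0) (HL0p : proper_length G L0) (mu : nat -> G -> R) :
  (forall n : nat, prob_supported_far G L0 n (mu n)) -> relative_FH G L0 mu -> ~ haagerup G.
Proof.
  intros Hmu (K & HK & HFH) Hh.
  destruct (haagerup_large_length G L0 (K + 1) HL0 HL0p Hh ltac:(lra))
    as (L & r & HL & HLb & Hr).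
  destruct (INR_unbounded r) as [n Hn].
  destruct (Hmu n) as (Hpos & S & HS & HSf & HS1).
  specialize (HFH L HL HLb n S HS).
  assert (sum_list (fun x => (K + 1) * mu n x) S <= sum_list (fun x => L x ^ 2 * mu n x) S).
  { apply sum_list_le; intros x Hx; apply Rmult_le_compat_r; [apply Hpos|].
    apply Hr; specialize (HSf x Hx); lra. }
  rewrite sum_list_scal, HS1 in *; lra.
Qed.

Theorem mainTheorem4 (G : Group) (HG : countable G) (L0 : G -> R)
    (HL0 : length_function G L0) (HL0p : proper_length G L0) :
  ~ haagerup G <->
  exists mu : nat -> G -> R,
    (forall n : nat, symmetric_measure G (mu n) /\ prob_supported_far G L0 n (mu n)) /\
    relative_FH G L0 mu.
Proof.
  split.
  - apply not_haagerup_relative_FH; assumption.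
  - intros (mu & Hmu & HFH).
    apply (relative_FH_not_haagerup G L0 HL0 HL0p mu); [apply Hmu|exact HFH].
Qed.
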